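(* Let $N\ge1$ be an integer and $\beta>0$ with $\beta/(N+1)<1$. Then the system of equations $$dx^i_t=\Bigl(\tfrac{\beta}{N+1}-1\Bigr)\Bigl(\frac1{x^i_t-x^{i-1}_t}-\frac1{x^{i+1}_t-x^i_t}\Bigr)dt+\sqrt2\,dw^i_t+dl^{i-1}_t-dl^i_t,\qquad i=1,\dots,N,$$ $$dl^i_t\ge0,\qquad l^i_t=\int_0^t \mathbf 1_{\{x^i_s=x^{i+1}_s\}}\,dl^i_s,\qquad i=0,\dots,N,$$ is ill-posed, i.e. it admits no solution in the sense of Itô calculus: there do not exist a filtered probability space, independent real Brownian motions $w^1,\dots,w^N$ on it, a continuous adapted $\overline{\Sigma}_N$-valued process $(x_t)_{t\ge0}$ and continuous adapted nondecreasing processes $l^0,\dots,l^N$ with $l^i_0=0$, satisfying these equations for all $t\ge0$, with the drift terms being almost surely well defined and integrable on compact time intervals.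
   Context: $\Sigma_N=\{x\in\mathbb R^N: 0<x^1<x^2<\dots<x^N<1\}$, with closure $\overline{\Sigma}_N$, and the convention $x^0\equiv0$, $x^{N+1}\equiv1$. ''Drift terms well defined and integrable'' means: almost surely $x_s\in\Sigma_N$ for Lebesgue-a.e. $s\ge0$ and $\int_0^t\bigl|\frac1{x^i_s-x^{i-1}_s}-\frac1{x^{i+1}_s-x^i_s}\bigr|ds<\infty$ for all $t\ge 0$ and $i=1,\dots,N$. *)

(* Defs.v *)
From HB Require Import structures.
From mathcomp Require Import all_boot all_order all_algebra.
From mathcomp Require Import all_classical all_reals all_analysis.

Set Implicit Arguments.
Unset Strict Implicit.
Unset Printing Implicit Defensive.

Import Order.TTheory GRing.Theory Num.Theory.
Import numFieldNormedType.Exports.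

Local Open Scope classical_set_scope.
Local Open Scope ring_scope.

(* Stochastic processes are functions [X : R -> T -> V] of the time and the
   sample point; only their values at times [t >= 0] are ever used. *)

Section Paths.
Variable R : realType.

Definition continuous_path (V : topologicalType) (f : R -> V) : Prop :=
  {within `[0, +oo[%classic, continuous f}.

Record increasing_path (f : R -> R) : Prop := IncreasingPath {
  increasing_path0 : f 0 = 0 ;
  increasing_path_nd : forall s t : R, 0 <= s -> s <= t -> f s <= f t ;
  increasing_path_cont : continuous_path f }.

(* [lebesgue_stieltjes_measure] is defined for functions on the whole line, so
   paths are extended by the constant [f 0] to negative times; the resulting
   measure does not charge ]-oo, 0]. *)
Definition path_extension (f : R -> R) : R -> R := fun s => f (Num.max 0 s).

Lemma path_extension_nd (f : R -> R) :
  increasing_path f -> nondecreasing (path_extension f).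
Proof.
move=> fP s t st; apply: (increasing_path_nd fP); first by rewrite le_max lexx.
by rewrite ge_max !le_max lexx st orbT.
Qed.

Lemma path_extension_rc (f : R -> R) :
  increasing_path f -> right_continuous (path_extension f).
Proof.
move=> fP; apply: right_continuousW => x.
have pos (s : R) : `[0, +oo[%classic (Num.max 0 s).
  by rewrite /= in_itv /= andbT le_max lexx.
have /subspace_continuousP/(_ _ (pos x)) fx := increasing_path_cont fP.
apply: cvg_trans fx.
have cmax : (Num.max 0 s : R) @[s --> x] --> (Num.max 0 x : R).
  by apply: (@continuous_max R R (cst 0) id x) => //; exact: cvg_cst.
move=> A fA; have := cmax _ fA; rewrite !nbhs_filterE /=.
by apply: filterS => s /= As; exact/As/pos.
Qed.

Definition stieltjes_fun (f : R -> R) (fP : increasing_path f) :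
    cumulative R R :=
  HB.pack_for (cumulative R R) (path_extension f)
    (isCumulative.Build R _ R (path_extension f)
      (path_extension_nd fP) (path_extension_rc fP)).

Definition stieltjes (f : R -> R) (fP : increasing_path f) :=
  lebesgue_stieltjes_measure (stieltjes_fun fP).

End Paths.

Section Processes.
Variables (R : realType) (d : measure_display) (T : measurableType d).
Variable P : probability T R.

Record filtration (F : R -> set_system T) : Prop := Filtration {
  filtration_sigma_algebra :
    forall t : R, 0 <= t -> sigma_algebra [set: T] (F t) ;
  filtration_measurable : forall t : R, 0 <= t -> F t `<=` measurable ;
  filtration_nd : forall s t : R, 0 <= s -> s <= t -> F s `<=` F t }.

Definition adapted (F : R -> set_system T) (X : R -> T -> R) : Prop :=
  forall t : R, 0 <= t -> forall B : set R, measurable B -> F t (X t @^-1` B).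

Definition process_sigma_algebra (X : R -> T -> R) : set_system T :=
  <<s [set A | exists2 t : R, 0 <= t &
         exists2 B : set R, measurable B & A = X t @^-1` B] >>.

Definition mutually_independent (I : finType) (G : I -> set_system T) : Prop :=
  forall (J : {set I}) (A : I -> set T),
    (forall i, i \in J -> G i (A i)) ->
    P (\bigcap_(i in [set i | i \in J]) A i) = (\prod_(i in J) P (A i))%E.

Definition increment (w : R -> T -> R) (s t : R) : T -> R :=
  fun om => w t om - w s om.

(* [normal_prob m s] has mean [m] and standard deviation [s]. *)
Record brownian_motion (F : R -> set_system T) (w : R -> T -> R) : Prop :=
    BrownianMotion {
  bm_adapted : adapted F w ;
  bm_continuous : {ae P, forall om, continuous_path (w ^~ om)} ;
  bm_start : {ae P, forall om, w 0 om = 0} ;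
  bm_gaussian : forall s t : R, 0 <= s -> s < t ->
    forall B : set R, measurable B ->
      P (increment w s t @^-1` B)
      = normal_prob 0 (Num.sqrt (t - s)) B ;
  bm_independent_increments : forall s t : R, 0 <= s -> s < t ->
    forall (A : set T) (B : set R), F s A -> measurable B ->
      P (A `&` increment w s t @^-1` B)
      = (P A * P (increment w s t @^-1` B))%E }.

End Processes.

Section Equation.
Variables (R : realType) (N : nat).

(* [pt x k] is x^k for k = 0, ..., N+1, with x^0 = 0 and x^(N+1) = 1; the
   row index [j : 'I_N] stands for the coordinate x^(j+1). *)
Definition pt (x : 'rV[R]_N) (k : nat) : R :=
  if k is j.+1 then (if insub j is Some i then x ord0 i else 1) else 0.

Definition Sigma : set 'rV[R]_N :=
  [set x | forall k, (k <= N)%N -> pt x k < pt x k.+1].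

(* For [j : 'I_N], the bracket in the drift of x^i with i = j+1. *)
Definition drift (x : 'rV[R]_N) (j : 'I_N) : R :=
  (pt x j.+1 - pt x j)^-1 - (pt x j.+2 - pt x j.+1)^-1.

Variable beta : R.
Variables (d : measure_display) (T : measurableType d) (P : probability T R).
Variable F : R -> set_system T.

(* For [j : 'I_N] and i = j+1, l^(i-1) is [l (widen_ord (leqnSn N) j)] and
   l^i is [l (lift ord0 j)]. *)
Record solution (w : 'I_N -> R -> T -> R) (x : R -> T -> 'rV[R]_N)
    (l : 'I_N.+1 -> R -> T -> R) : Prop := Solution {
  sol_filtration : filtration F ;
  sol_brownian : forall j, brownian_motion P F (w j) ;
  sol_independent :
    mutually_independent P (fun j => process_sigma_algebra (w j)) ;
  sol_x_adapted : forall j, adapted F (fun t om => x t om ord0 j) ;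
  sol_x_continuous : forall om, continuous_path (x ^~ om) ;
  sol_x_closure : forall (t : R) om, 0 <= t -> closure Sigma (x t om) ;
  sol_l_adapted : forall i, adapted F (l i) ;
  sol_l_increasing : forall i om, increasing_path (fun t => l i t om) ;
  sol_drift_defined : {ae P, forall om,
    {ae lebesgue_measure, forall s : R, 0 <= s -> Sigma (x s om)}} ;
  sol_drift_integrable : {ae P, forall om, forall (t : R) j, 0 <= t ->
    lebesgue_measure.-integrable `[0, t]%classic
      (fun s => (drift (x s om) j)%:E)} ;
  sol_equation : {ae P, forall om, forall (t : R) j, 0 <= t ->
    x t om ord0 j =
      x 0 om ord0 j
      + (beta / N.+1%:R - 1)
        * \int[lebesgue_measure]_(s in `[0, t]) drift (x s om) j
      + Num.sqrt 2 * w j t om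
      + l (widen_ord (leqnSn N) j) t om - l (lift ord0 j) t om} ;
  sol_l_support : {ae P, forall om, forall (t : R) (i : 'I_N.+1), 0 <= t ->
    (l i t om)%:E =
      (\int[stieltjes (sol_l_increasing i om)]_(s in `[0%R, t])
         (\1_[set s | pt (x s om) i = pt (x s om) i.+1] s)%:E)%E} }.

End Equation.

(* Main.v *)
Require Import Defs.
From HB Require Import structures.
From mathcomp Require Import all_boot all_order all_algebra.
From mathcomp Require Import all_classical all_reals all_analysis.
From mathcomp Require Import measurable_realfun ring lra zify.

(** The drift constant [c = beta / (N + 1) - 1] is negative, i.e. neighbouring
    points attract each other.  Let [y] be the deviation from the equally spaced
    configuration.  Formally, |y|^2/2 has Ito drift at least
    [N t - const * sum_k l^k]: the attraction contributes a nonnegative term by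
    convexity of [1/g], the Brownian motions contribute [N t], and the
    reflections pull the points inwards.  Integrability of the drift bounds
    [int 1/g_k ds] for every gap [g_k], and this makes the reflections harmless:
    adding to |y|^2/2 suitable multiples of [e g / (e + g)], with [g] ranging
    over the distances between the points and to the boundary, a perturbation
    of size O(e), compensates every [dl^k], while the second-order term it
    creates is dominated by [1/g] and vanishes as [e] tends to 0.  Hence the
    bounded function |y|^2/2 has drift [N t] up to a martingale of variance
    O(t), which is absurd for large [t].

    Stochastic integrals are avoided: everything is done on Riemann sums along
    regular partitions, the sums against [dw] and [dw^2 - dt] being controlled
    in L^2 by independence of the increments, and the limits are taken with
    Fatou's lemma. *)

Set Implicit Arguments.
Unset Strict Implicit.
Unset Printing Implicit Defensive.

Import Order.TTheory GRing.Theory Num.Theory.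
Import numFieldNormedType.Exports.
Import HBNNSimple.

Local Open Scope classical_set_scope.
Local Open Scope ring_scope.

Local Notation "x $ i" := (x ord0 i) (at level 8, i at level 8, format "x $ i").

(** * Gaussian moments *)

(** At a collision [x^k = x^(k+1)] the deviations satisfy [y^(k+1) - y^k = -1/(N+1)], so reflection
    lowers |y|^2/2: the local times enter with the wrong sign. A correction with slope 1 at [g = 0]
    reverses the sign, but to be of size [e] it must bend at a scale 1/[e] for [g] below [e]. The
    quadratic coefficient in its Taylor inequality, [e / (e + g)^2], tends to 0 for [g > 0] and is
    at most [1/g], so its time integral vanishes by dominated convergence once [1/g] is integrable
    in time. Integrability is essential here: for a reflected Brownian motion [1/g] is not
    integrable, and the bending term converges to a multiple of the local time instead of vanishing.

    The correction makes the coefficient of [dw^2 - dt] as large as 1/[e], but the variance of these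
    sums carries a factor of the mesh. Hence the partition is refined first with [e] fixed, and only
    then does [e] tend to 0; the surviving variance bound depends on the gradient alone and is
    uniform in [e]. *)

Section AffineRintegral.
Context d (T : measurableType d) (R : realType) (P : probability T R).

Lemma Rintegral_affine (a b : R) (f : T -> R) :
  P.-integrable [set: T] (EFin \o f) ->
  \int[P]_x (a + b * f x) = a + b * \int[P]_x f x.
Proof.
move=> fi; rewrite (@RintegralD _ _ _ P setT (cst a) (fun x => b * f x))//.
- by rewrite RintegralZl// Rintegral_cst//= [P _]probability_setT mulr1.
- exact: finite_measure_integrable_cst.
- by apply: (integrableZl _ b fi).
Qed.

(** Extracts polynomial moments from exponential ones known exactly: [g] will be an exponential and
    [a + b f] its tangent from below. *)
Lemma le_Rintegral_affine (a b c : R) (f g : T -> R) :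
  P.-integrable [set: T] (EFin \o f) -> measurable_fun [set: T] g ->
  (forall x, a + b * f x <= g x) -> (forall x, 0 <= g x) ->
  (\int[P]_x (g x)%:E = c%:E)%E ->
  a + b * \int[P]_x f x <= c.
Proof.
move=> fi mg fg g0 gc; rewrite -Rintegral_affine//.
rewrite -[leRHS]/(fine c%:E) -gc; apply: le_Rintegral => //.
- apply: (@integrableD _ _ _ P setT _ (EFin \o cst a) (EFin \o (fun x => b * f x))) => //.
    exact: finite_measure_integrable_cst.
  by apply: (integrableZl _ b fi).
- apply/integrableP; split; first exact/measurable_EFinP.
  by under eq_integral do rewrite /= ger0_norm//; rewrite gc ltry.
Qed.

End AffineRintegral.

Section NormalMoments.
Variable R : realType.
Local Notation mu := (@lebesgue_measure R).

Lemma ge0_integral_normal_prob (m s : R) (f : R -> \bar R) :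
  measurable_fun [set: R] f -> (forall x, 0 <= f x)%E ->
  (\int[normal_prob m s]_x f x = \int[mu]_x (f x * (normal_pdf m s x)%:E))%E.
Proof.
move=> mf f0; pose g := nnsfun_approx measurableT mf.
have mpdf : measurable_fun [set: R] (EFin \o normal_pdf m s).
  by apply/measurable_EFinP; exact: measurable_normal_pdf.
have gf x : EFin \o g^~ x @ \oo --> f x by apply: cvg_nnsfun_approx.
have pdf0 x : (0 <= (normal_pdf m s x)%:E)%E by rewrite lee_fin normal_pdf_ge0.
have mg n : measurable_fun [set: R] (EFin \o g n) by exact/measurable_EFinP.
have ndg x : {homo (fun n => (g n x)%:E) : a b / (a <= b)%N >-> (a <= b)%E}.
  by move=> a b ab; rewrite lee_fin; exact/lefP/nd_nnsfun_approx.
transitivity (limn (fun n => \int[normal_prob m s]_x (g n x)%:E))%E.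
  rewrite -monotone_convergence//.
  - by apply: eq_integral => x _; apply/esym/cvg_lim => //; exact: gf.
  - by move=> n x _; rewrite lee_fin.
transitivity (limn (fun n => \int[mu]_x ((g n x)%:E * (normal_pdf m s x)%:E)))%E;
    last first.
  rewrite -monotone_convergence//.
  - apply: eq_integral => x _; apply/cvg_lim => //.
    by apply: cvgeZr => //; exact: gf.
  - by move=> n; apply: emeasurable_funM; [exact: mg|exact: mpdf].
  - by move=> n x _; rewrite mule_ge0// lee_fin.
  - by move=> x _ a b ab; rewrite lee_wpmul2r//; exact: ndg.
congr (limn _); apply/funext => n.
have mind r : measurable_fun [set: R] (fun x => (r * \1_(g n @^-1` [set r]) x)%:E).
  by apply/measurable_EFinP; apply: measurable_funM => //; exact: measurable_indic.
have ind0 r x : (0 <= (r * \1_(g n @^-1` [set r]) x)%:E)%E.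
  by rewrite EFinM nnfun_muleindic_ge0.
under eq_integral do rewrite fimfunE -fsumEFin//.
rewrite ge0_integral_fsum//.
under [RHS]eq_integral => x _.
  rewrite fimfunE -fsumEFin// ge0_mule_fsuml; last by move=> r; exact: ind0.
  over.
rewrite [RHS]ge0_integral_fsum//; last 2 first.
  - by move=> r; apply: emeasurable_funM; [exact: mind|exact: mpdf].
  - by move=> r x _; rewrite mule_ge0.
apply: eq_fsbigr => r _.
have mA : measurable (g n @^-1` [set r]) by [].
move: (g n @^-1` [set r]) mA (@preimage_nnfun0 _ _ (g n) r) => A mA A0.
under [RHS]eq_integral do rewrite EFinM -muleA.
under [LHS]eq_integral do rewrite EFinM.
(* A nonnegative function never takes a value [r < 0]; once this case is set aside, the scalar is
   nonnegative and can leave the integral. *)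
have [r0|r0] := ltP r 0.
  by rewrite A0// !integral0_eq// => x _; rewrite indic0 ?mul0e mule0.
have mI : measurable_fun [set: R] (fun x => (\1_A x)%:E : \bar R).
  by apply/measurable_EFinP; exact: measurable_indic.
rewrite !ge0_integralZl//; last 2 first.
  - by apply: emeasurable_funM; [exact: mI|exact: mpdf].
  - by move=> x _; rewrite mule_ge0// lee_fin.
congr (_ * _)%E.
rewrite integral_indic// setIT /normal_prob [LHS]integral_mkcond.
apply: eq_integral => x _; rewrite restrict_EFin/= patchE indicE.
by case: ifPn => _; rewrite ?mul1e ?mul0e.
Qed.


Lemma normal_peakE (s : R) : 0 < s -> normal_peak s = (s * Num.sqrt (pi *+ 2))^-1.
Proof.
move=> s0; rewrite /normal_peak -mulrnAr sqrtrM ?sqr_ge0//.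
by rewrite sqrtr_sqr gtr0_norm.
Qed.

(** The integrand is the likelihood ratio of the normal laws with means [m] and 0. *)
Lemma integral_normal_expR_linear (m s : R) : 0 < s ->
  (\int[normal_prob 0 s]_z (expR ((2 * m * z - m ^+ 2) / (2 * s ^+ 2)))%:E = 1)%E.
Proof.
move=> s0; have sN0 : s != 0 by rewrite gt_eqF.
rewrite ge0_integral_normal_prob; last 2 first.
- apply/measurable_EFinP; apply: measurableT_comp => //.
  by apply: measurable_funM => //; apply: measurable_funB => //; exact: measurable_funM.
- by move=> x; rewrite lee_fin expR_ge0.
rewrite -(integral_normal_pdf m s); apply: eq_integral => x _.
rewrite -EFinM !normal_pdfE//= /normal_fun; congr EFin.
rewrite mulrCA -expRD; congr (_ * expR _).
by rewrite -(mulr_natr (s ^+ 2) 2); field.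
Qed.

(** Up to the factor [r / s], the integrand is the likelihood ratio of the centred normal laws with
    deviations [r] and [s]. *)
Lemma integral_normal_expR_sqr (r s : R) : 0 < r -> 0 < s ->
  (\int[normal_prob 0 s]_z (expR ((s ^- 2 - r ^- 2) / 2 * z ^+ 2))%:E = (r / s)%:E)%E.
Proof.
move=> r0 s0; have sN0 : s != 0 by rewrite gt_eqF.
have rN0 : r != 0 by rewrite gt_eqF.
rewrite ge0_integral_normal_prob; last 2 first.
- apply/measurable_EFinP; apply: measurableT_comp => //.
  exact: measurable_funM.
- by move=> x; rewrite lee_fin expR_ge0.
transitivity (\int[mu]_x ((r / s)%:E * (normal_pdf 0 r x)%:E))%E; last first.
  rewrite ge0_integralZl//=.
  - by rewrite integral_normal_pdf mule1.
  - by apply/measurable_EFinP; exact: measurable_normal_pdf.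
  - by move=> x _; rewrite lee_fin normal_pdf_ge0.
  - by rewrite lee_fin divr_ge0// ltW.
apply: eq_integral => x _.
rewrite -!EFinM !normal_pdfE//= /normal_fun !normal_peakE//; congr EFin.
have p0 : Num.sqrt (pi *+ 2 : R) != 0.
  by rewrite gt_eqF// sqrtr_gt0 mulrn_wgt0// pi_gt0.
rewrite mulrCA -expRD [RHS]mulrA; congr (_ * expR _); first by field; rewrite p0 rN0.
by rewrite -!(mulr_natr (_ ^+ 2) 2); field; rewrite rN0.
Qed.

Lemma sqr_le_expR (x : R) : 0 <= x -> x ^+ 2 <= 4 * expR x.
Proof.
move=> x0; have := expR_ge1Dx (x / 2).
rewrite [in X in _ -> _ <= _ * X](_ : x = x / 2 + x / 2); last by field.
rewrite expRD; set e := expR _ => xe.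
have : (1 + x / 2) * (1 + x / 2) <= e * e by apply: ler_pM => //; lra.
nra.
Qed.

(** For [r = sqrt 2 * s] the exponent is [y = z^2 / (4 s^2)], and [z^4 = 16 s^4 y^2 <= 64 s^4 e^y].
    The integral of [e^y] is [sqrt 2 <= 2], which gives 128. *)
Lemma normal_moment4 (s : R) : 0 < s ->
  (\int[normal_prob 0 s]_z (z ^+ 4)%:E <= (128 * s ^+ 4)%:E)%E.
Proof.
move=> s0; have sN0 : s != 0 by rewrite gt_eqF.
pose r := Num.sqrt 2 * s.
have r0 : 0 < r by rewrite mulr_gt0// sqrtr_gt0.
have r2 : r ^- 2 = s ^- 2 / 2.
  by rewrite /r exprMn sqr_sqrtr//; field.
apply: (@le_trans _ _ (\int[normal_prob 0 s]_z
    ((64 * s ^+ 4)%:E * (expR ((s ^- 2 - r ^- 2) / 2 * z ^+ 2))%:E))%E).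
  apply: ge0_le_integral => //.
  - by move=> x _; rewrite lee_fin -[4%N]/(2 * 2)%N exprM sqr_ge0.
  - by apply/measurable_EFinP.
  - apply/measurable_EFinP; apply: measurable_funM => //.
    by apply: measurableT_comp => //; exact: measurable_funM.
  - move=> z _; rewrite -EFinM lee_fin.
    pose y := z ^+ 2 / (4 * s ^+ 2).
    rewrite (_ : (s ^- 2 - r ^- 2) / 2 * z ^+ 2 = y); last first.
      by rewrite r2 /y; field.
    have y0 : 0 <= y by rewrite divr_ge0 ?sqr_ge0// mulr_ge0// sqr_ge0.
    rewrite (_ : z ^+ 4 = 16 * s ^+ 4 * y ^+ 2); last by rewrite /y; field.
    rewrite (_ : 64 * s ^+ 4 * expR y = 16 * s ^+ 4 * (4 * expR y)); last by ring.
    by rewrite ler_wpM2l ?sqr_le_expR// mulr_ge0// exprn_ge0// ltW.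
rewrite ge0_integralZl//=.
- rewrite integral_normal_expR_sqr// -EFinM lee_fin /r mulfK//.
  have : Num.sqrt 2 <= 2 :> R.
    have := sqr_sqrtr (ler0n R 2); have := sqrtr_ge0 (2 : R); nra.
  have : 0 <= s ^+ 4 by rewrite exprn_ge0// ltW.
  by nra.
- apply/measurable_EFinP.
  by apply: measurableT_comp => //; exact: measurable_funM.
- by rewrite lee_fin mulr_ge0// exprn_ge0// ltW.
Qed.

Lemma normal_integrableX (s : R) (k : nat) : 0 < s -> (k <= 4)%N ->
  (normal_prob 0 s).-integrable [set: R] (fun z => (z ^+ k)%:E).
Proof.
move=> s0 k4.
have i4 : (normal_prob 0 s).-integrable [set: R] (fun z => (z ^+ 4)%:E).
  apply/integrableP; split; first exact/measurable_EFinP.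
  apply: le_lt_trans (ltry (128 * s ^+ 4)).
  apply: le_trans (normal_moment4 s0).
  apply: ge0_le_integral => //.
  - by apply/measurableT_comp => //; exact/measurable_EFinP.
  - exact/measurable_EFinP.
  - move=> x _; rewrite lee_fin ger0_norm//.
    by rewrite -[4%N]/(2 * 2)%N exprM sqr_ge0.
have i1 : (normal_prob 0 s).-integrable [set: R] (cst 1%E).
  by apply: finite_measure_integrable_cst.
apply: (le_integrable measurableT _ _ (integrableD measurableT i1 i4)).
  exact/measurable_EFinP.
move=> x _; rewrite /= lee_fin normrX.
have x4 : x ^+ 4 = `|x| ^+ 4.
  by rewrite -normrX ger0_norm// -[4%N]/(2 * 2)%N exprM sqr_ge0.
rewrite x4 (@ger0_norm _ (1 + _)) ?addr_ge0 ?exprn_ge0//.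
have [x1|x1] := leP `|x| 1.
  by rewrite (le_trans (exprn_ile1 k _ x1))// lerDl exprn_ge0.
by rewrite (le_trans (ler_weXn2l (ltW x1) k4))// lerDr.
Qed.

Lemma normal_mean0 (s : R) : 0 < s -> \int[normal_prob 0 s]_z z = 0.
Proof.
move=> s0; set M := (X in X = 0).
have i1 : (normal_prob 0 s).-integrable [set: R] (EFin \o id).
  exact: (@normal_integrableX s 1).
have s20 : 0 < s ^+ 2 by rewrite exprn_gt0.
(* [e^u >= 1 + u] integrates to an inequality linear in the mean. *)
have key m : 2 * m * M <= m ^+ 2.
  have : (1 - m ^+ 2 / (2 * s ^+ 2)) + m / s ^+ 2 * M <= 1.
    apply: (@le_Rintegral_affine _ _ _ (normal_prob 0 s) _ _ _ id
      (fun z => expR ((2 * m * z - m ^+ 2) / (2 * s ^+ 2)))) => //.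
    - apply: measurableT_comp => //; apply: measurable_funM => //.
      by apply: measurable_funB => //; exact: measurable_funM.
    - move=> x; apply: le_trans (expR_ge1Dx _); rewrite le_eqVlt; apply/orP; left.
      by apply/eqP; field; rewrite gt_eqF.
    - exact: integral_normal_expR_linear.
  rewrite -addrA gerDl -(pmulr_lle0 _ (mulr_gt0 (ltr0n _ 2) s20)).
  rewrite (_ : (_ + _) * _ = 2 * m * M - m ^+ 2); first by rewrite subr_le0.
  by field; rewrite gt_eqF.
have := key M; have := sqr_ge0 M; rewrite -mulrA -expr2 => M0 M1.
by apply/eqP; rewrite -sqrf_eq0 eq_le M0 andbT; lra.
Qed.

Lemma normal_variance (s : R) : 0 < s -> \int[normal_prob 0 s]_z (z ^+ 2) = s ^+ 2.
Proof.
move=> s0; set V := (X in X = _).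
have i2 : (normal_prob 0 s).-integrable [set: R] (EFin \o (fun z => z ^+ 2)).
  exact: (@normal_integrableX s 2).
have sN0 : s != 0 by rewrite gt_eqF.
(* [e^u >= 1 + u] for [u = (s^-2 - r^-2) z^2 / 2]; then let [r] tend to [s] from
   both sides. *)
have key r : 0 < r -> 1 + (s ^- 2 - r ^- 2) / 2 * V <= r / s.
  move=> r0; apply: (@le_Rintegral_affine _ _ _ (normal_prob 0 s) _ _ _ _
      (fun z => expR ((s ^- 2 - r ^- 2) / 2 * z ^+ 2))) => //.
  - by apply: measurableT_comp => //; exact: measurable_funM.
  - by move=> x; exact: expR_ge1Dx.
  - exact: integral_normal_expR_sqr.
have key2 r : 0 < r -> (r - s) * (V * (r + s)) <= (r - s) * (2 * r ^+ 2 * s).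
  move=> r0; have rN0 : r != 0 by rewrite gt_eqF.
  have c0 : 0 <= 2 * r ^+ 2 * s ^+ 2 by rewrite mulr_ge0 ?sqr_ge0// mulr_ge0 ?sqr_ge0.
  have := ler_wpM2l c0 (key r r0); rewrite mulrDr mulr1.
  rewrite (_ : _ * (_ / 2 * V) = (r - s) * (V * (r + s))); last by field; rewrite rN0.
  rewrite (_ : _ * (r / s) = 2 * r ^+ 2 * s ^+ 2 + (r - s) * (2 * r ^+ 2 * s)).
    by rewrite lerD2l.
  by field.
have up e : 0 < e -> V * (2 * s + e) <= 2 * (s + e) ^+ 2 * s.
  move=> e0; have := key2 (s + e) (addr_gt0 s0 e0).
  rewrite addrC addKr ler_pM2l//.
  by rewrite (_ : s + e + s = 2 * s + e); last by ring.
have dn e : 0 < e -> e < s -> 2 * (s - e) ^+ 2 * s <= V * (2 * s - e).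
  move=> e0 es; have := key2 (s - e); rewrite subr_gt0 es => /(_ isT).
  rewrite (_ : s - e - s = - e); last by ring.
  rewrite !mulNr lerN2 ler_pM2l//.
  by rewrite (_ : s - e + s = 2 * s - e); last by ring.
have s2 : 0 < s ^+ 2 by rewrite exprn_gt0.
have V0 : 0 <= V by apply: Rintegral_ge0 => x _; exact: sqr_ge0.
have [Vs|Vs|//] := ltgtP V (s ^+ 2).
(* With [4 s e = s^2 - V], the first-order loss [4 s^2 e] in [dn] is only half of [2 s (s^2 - V)],
   so [dn] fails. The other case is symmetric, with [e] capped at [s] to control the quadratic
   term. *)
- pose e := (s ^+ 2 - V) / (4 * s).
  have e0 : 0 < e by rewrite divr_gt0 ?subr_gt0// mulr_gt0.
  have es : e * (4 * s) = s ^+ 2 - V by rewrite /e divfK// mulf_neq0.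
  have : e < s by nra.
  by move=> /(dn e e0); nra.
- pose e := Num.min s ((V - s ^+ 2) / (4 * s)).
  have e0 : 0 < e by rewrite lt_min s0 divr_gt0 ?subr_gt0// mulr_gt0.
  have e1 : e <= s by rewrite ge_min lexx.
  have e2 : e * (4 * s) <= V - s ^+ 2.
    by rewrite -ler_pdivlMr ?mulr_gt0// ge_min lexx orbT.
  have := up e e0; nra.
Qed.

(** The terms linear in [u] integrate to 0, so [u^2] keeps the coefficient 1 and the bound can be
    iterated over time steps. The mixed term of odd degree is removed by
    [(p + q)^2 <= 2 p^2 + 2 q^2], and [258 = 2 * 128 + 2] comes from the fourth moment. *)
Lemma normal_square_le (s u a b : R) : 0 < s ->
  (\int[normal_prob 0 s]_z ((u + a * z + b * (z ^+ 2 - s ^+ 2)) ^+ 2)%:E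
   <= (u ^+ 2 + 2 * a ^+ 2 * s ^+ 2 + 258 * b ^+ 2 * s ^+ 4)%:E)%E.
Proof.
move=> s0; pose N := normal_prob 0 s.
have iX k : (k <= 4)%N -> N.-integrable [set: R] (EFin \o (fun z => z ^+ k)).
  by move=> k4; exact: normal_integrableX.
have iZ c k : (k <= 4)%N -> N.-integrable [set: R] (EFin \o (fun z => c * z ^+ k)).
  by move=> k4; apply: (integrableZl _ c (iX k k4)).
pose c0 := u ^+ 2 - 2 * u * b * s ^+ 2 + 2 * b ^+ 2 * s ^+ 4.
pose p4 z : R := c0 + 2 * b ^+ 2 * z ^+ 4.
pose p2 z : R := (2 * u * b + 2 * a ^+ 2) * z ^+ 2.
pose p1 z : R := 2 * u * a * z ^+ 1.
have i4 : N.-integrable [set: R] (EFin \o p4).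
  apply: (@integrableD _ _ _ N setT _ (EFin \o cst c0)
    (EFin \o (fun z => 2 * b ^+ 2 * z ^+ 4))) => //; last exact: iZ.
  exact: finite_measure_integrable_cst.
have i42 : N.-integrable [set: R] (EFin \o (fun z => p4 z + p2 z)).
  by apply: (@integrableD _ _ _ N setT _ (EFin \o p4) (EFin \o p2)) => //; exact: iZ.
have i421 : N.-integrable [set: R] (EFin \o (fun z => p4 z + p2 z + p1 z)).
  apply: (@integrableD _ _ _ N setT _ (EFin \o (fun z => p4 z + p2 z)) (EFin \o p1)) => //.
  exact: iZ.
have le_p z : (u + a * z + b * (z ^+ 2 - s ^+ 2)) ^+ 2 <= p4 z + p2 z + p1 z.
  rewrite /p4 /p2 /p1 /c0 -subr_ge0.
  rewrite (_ : _ - _ = (a * z - b * (z ^+ 2 - s ^+ 2)) ^+ 2 + (b * z * s) ^+ 2 * 4); last by ring.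
  by rewrite addr_ge0 ?sqr_ge0// mulr_ge0// sqr_ge0.
have mp : measurable_fun [set: R] (fun z => (p4 z + p2 z + p1 z)%:E).
  exact: measurable_int i421.
apply: (@le_trans _ _ (\int[N]_z (p4 z + p2 z + p1 z)%:E)%E).
  apply: ge0_le_integral => //.
  - by move=> z _; rewrite lee_fin sqr_ge0.
  - apply/measurable_EFinP; apply: measurable_funX; apply: measurable_funD.
      by apply: measurable_funD => //; exact: measurable_funM.
    by apply: measurable_funM => //; exact: measurable_funB.
  - by move=> z _; rewrite lee_fin.
rewrite -[leLHS]fineK; last exact: integrable_fin_num.
rewrite lee_fin -/(Rintegral N setT (fun z => p4 z + p2 z + p1 z)).
rewrite (@RintegralD _ _ _ N setT (fun z => p4 z + p2 z) p1)//; last exact: iZ.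
rewrite (@RintegralD _ _ _ N setT p4 p2)//; last exact: iZ.
rewrite Rintegral_affine; last exact: iX.
rewrite !RintegralZl//; [|exact: iX|exact: iX].
rewrite normal_variance// (_ : \int[N]_x x ^+ 1 = 0); last exact: normal_mean0.
have M4 : \int[N]_z z ^+ 4 <= 128 * s ^+ 4.
  rewrite -lee_fin /Rintegral fineK; last exact: (integrable_fin_num _ (iX 4 _)).
  exact: normal_moment4.
have := ler_wpM2l (mulr_ge0 (ler0n R 2) (sqr_ge0 b)) M4.
by rewrite /c0; set M := Rintegral _ _ _; lra.
Qed.

End NormalMoments.

(** * Martingale transforms of Brownian motion *)

Section BrownianIncrements.
Variables (R : realType) (d : measure_display) (T : measurableType d).
Variables (P : probability T R) (F : R -> set_system T).
Hypothesis filF : filtration F.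

Definition measurable_at (t : R) (X : T -> R) : Prop :=
  measurable_fun [set: g_sigma_algebraType (F t)] X.

Lemma filtration_measurableE (t : R) : 0 <= t -> (F t).-sigma.-measurable = F t.
Proof. by move=> t0; rewrite measurable_g_measurableTypeE//; exact: filtration_sigma_algebra. Qed.

Lemma adapted_measurable_at (X : R -> T -> R) (t : R) :
  adapted F X -> 0 <= t -> measurable_at t (X t).
Proof.
move=> aX t0 _ B mB; rewrite setTI; apply: sub_sigma_algebra; exact: aX.
Qed.

Lemma measurable_at_le (s t : R) (X : T -> R) :
  0 <= s -> s <= t -> measurable_at s X -> measurable_at t X.
Proof.
move=> s0 st mX _ B mB; have := mX measurableT B mB.
rewrite filtration_measurableE// => ?; rewrite filtration_measurableE ?(le_trans s0)//.
exact: (filtration_nd filF s0 st).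
Qed.

Lemma measurable_at_fun (t : R) (X : T -> R) :
  0 <= t -> measurable_at t X -> measurable_fun [set: T] X.
Proof.
move=> t0 mX _ B mB; have := mX measurableT B mB.
by rewrite filtration_measurableE//; exact: filtration_measurable.
Qed.

Variable w : R -> T -> R.
Hypothesis bw : brownian_motion P F w.

Lemma measurable_at_increment (s t : R) : 0 <= s -> s <= t ->
  measurable_at t (increment w s t).
Proof.
move=> s0 st; apply: measurable_funB.
  by apply: adapted_measurable_at (bm_adapted bw) (le_trans s0 st).
by apply: (measurable_at_le s0 st); apply: adapted_measurable_at (bm_adapted bw) s0.
Qed.

Section JointLaw.
Variables (s t : R).
Hypotheses (s0 : 0 <= s) (st : s < t).
Local Notation G := (g_sigma_algebraType (F s)).
Local Notation RR := (measurableTypeR R).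
Local Notation N := (normal_prob 0 (Num.sqrt (t - s))).

(** The identity, viewed as a map to the sample space with the coarser sigma-algebra [F s]; it lets
    the past be one factor of a product space. *)
Let past (om : T) : G := om.

Let measurable_past : measurable_fun [set: T] past.
Proof.
move=> _ A; rewrite filtration_measurableE// setTI => FA.
exact: (filtration_measurable filF s0).
Qed.

Let joint (om : T) : G * RR := (past om, increment w s t om).

Let measurable_joint : measurable_fun [set: T] joint.
Proof.
apply: measurable_fun_pair; first exact: measurable_past.
apply: (@measurable_at_fun t); [exact: le_trans (ltW st)|].
by apply: measurable_at_increment => //; exact: ltW.
Qed.

Let past_mfun : {mfun T >-> G} :=
  HB.pack past (isMeasurableFun.Build _ _ _ _ past measurable_past).

Let joint_mfun : {mfun T >-> (G * RR)%type} :=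
  HB.pack joint (isMeasurableFun.Build _ _ _ _ joint measurable_joint).

(* The increment being independent of [F s], the law of the pair
   (sample point seen by [F s], increment) is a product measure. *)
Lemma ge0_expectation_increment (f : G * RR -> \bar R) :
  measurable_fun [set: G * RR] f -> (forall x, 0 <= f x)%E ->
  (\int[P]_om f (om, increment w s t om) = \int[P]_om \int[N]_z f (om, z))%E.
Proof.
move=> mf f0.
transitivity (\int[distribution P joint_mfun]_x f x)%E.
  by rewrite ge0_integral_pushforward.
transitivity (\int[distribution P past_mfun \x N]_x f x)%E.
  apply: eq_measure_integral => A mA _; apply/esym.
  apply: product_measure_unique => // B C mB mC.
  rewrite /= /distribution /pushforward.
  have FB : F s B by rewrite -filtration_measurableE.
  have := bm_independent_increments bw s0 st FB mC.
  by rewrite (bm_gaussian bw s0 st mC).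
rewrite fubini_tonelli1//= /fubini_F ge0_integral_pushforward//=.
  exact: measurable_fun_fubini_tonelli_F.
by move=> om _; apply: integral_ge0.
Qed.

End JointLaw.

Section MartingaleTransform.
Variable h : R.
Hypothesis h0 : 0 < h.
Local Notation tm m := (m%:R * h).
Local Notation dw m := (increment w (tm m) (tm m.+1)).
Variables (a b : nat -> T -> R) (A B : R).
Hypotheses (ma : forall m, measurable_at (tm m) (a m))
  (mb : forall m, measurable_at (tm m) (b m)).
Hypotheses (aA : forall m om, a m om ^+ 2 <= A) (bB : forall m om, b m om ^+ 2 <= B).

(** A discrete stochastic integral: the coefficients at the left end of each cell multiply [dw] and
    the compensated square [dw^2 - h]. *)
Definition martingale_transform (k : nat) (om : T) : R :=
  \sum_(m < k) (a m om * dw m om + b m om * (dw m om ^+ 2 - h)).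

Lemma measurable_at_martingale_transform k :
  measurable_at (tm k) (martingale_transform k).
Proof.
elim: k => [|k IHk].
  rewrite (_ : martingale_transform 0 = cst 0); first exact: measurable_cst.
  by apply/funext => om; rewrite /martingale_transform big_ord0.
rewrite (_ : martingale_transform k.+1 = fun om => martingale_transform k om +
  (a k om * dw k om + b k om * (dw k om ^+ 2 - h))); last first.
  by apply/funext => om; rewrite /martingale_transform big_ord_recr.
have k0 : 0 <= tm k by rewrite mulr_ge0// ltW.
have kk : tm k <= tm k.+1 by rewrite ler_wpM2r ?ler_nat// ltW.
have up X : measurable_at (tm k) X -> measurable_at (tm k.+1) X by exact: measurable_at_le.
have mw := measurable_at_increment k0 kk.
apply: measurable_funD; first exact: up.
apply: measurable_funD; first by apply: measurable_funM => //; exact: up.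
apply: measurable_funM; first exact: up.
by apply: measurable_funB => //; exact: measurable_funX.
Qed.

(** Orthogonality of martingale increments: integrating the new increment first, with the past
    frozen as [u], reduces the claim to [normal_square_le] with [s = sqrt h]. *)
Lemma martingale_transform_step k :
  (\int[P]_om (martingale_transform k.+1 om ^+ 2)%:E <=
   \int[P]_om (martingale_transform k om ^+ 2)%:E
     + (2 * A * h + 258 * B * h ^+ 2)%:E)%E.
Proof.
have k0 : 0 <= tm k by rewrite mulr_ge0// ltW.
have kk : tm k < tm k.+1 by rewrite ltr_pM2r// ltr_nat.
have hE : tm k.+1 - tm k = h by rewrite -mulrBl -natrB// subSnn mul1r.
pose f (x : g_sigma_algebraType (F (tm k)) * measurableTypeR R) : \bar R :=
  ((martingale_transform k x.1 + a k x.1 * x.2 + b k x.1 * (x.2 ^+ 2 - h)) ^+ 2)%:E.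
have mfst (X : T -> R) : measurable_at (tm k) X ->
    measurable_fun [set: g_sigma_algebraType (F (tm k)) * measurableTypeR R] (X \o fst).
  by move=> mX; apply: (measurableT_comp mX); exact: measurable_fst.
have mf : measurable_fun setT f.
  apply/measurable_EFinP; apply: measurable_funX; apply: measurable_funD.
    apply: measurable_funD; first exact: (mfst _ (@measurable_at_martingale_transform k)).
    by apply: measurable_funM; [exact: (mfst _ (@ma k))|exact: measurable_snd].
  apply: measurable_funM; first exact: (mfst _ (@mb k)).
  apply: measurable_funB => //; apply: measurable_funX; exact: measurable_snd.
have f0 x : (0 <= f x)%E by rewrite lee_fin sqr_ge0.
rewrite (_ : (\int[P]_om _)%E = \int[P]_om f (om, dw k om))%E; last first.
  apply: eq_integral => om _.
  by rewrite /f /= {1}/martingale_transform big_ord_recr/= addrA.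
rewrite ge0_expectation_increment// hE.
have mM : measurable_fun [set: T] (martingale_transform k).
  by apply: (measurable_at_fun k0); exact: measurable_at_martingale_transform.
have AB : 0 <= 2 * A * h + 258 * B * h ^+ 2.
  have A0 : 0 <= A := le_trans (sqr_ge0 _) (aA 0%N point).
  have B0 : 0 <= B := le_trans (sqr_ge0 _) (bB 0%N point).
  by rewrite addr_ge0// mulr_ge0// ?mulr_ge0 ?sqr_ge0// ltW.
apply: (@le_trans _ _ (\int[P]_om ((martingale_transform k om ^+ 2)%:E +
    (2 * A * h + 258 * B * h ^+ 2)%:E))%E).
  apply: ge0_le_integral => //.
  - by move=> om _; apply: integral_ge0.
  - move=> _ C mC.
    have := measurable_fun_fubini_tonelli_F (m2 := normal_prob 0 (Num.sqrt h)) f mf f0.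
    move=> /(_ measurableT C mC); rewrite filtration_measurableE//.
    exact: (filtration_measurable filF k0).
  - apply: emeasurable_funD => //; apply/measurable_EFinP; exact: measurable_funX.
  - move=> om _; rewrite /f/=.
    have sh : 0 < Num.sqrt h by rewrite sqrtr_gt0.
    have := normal_square_le (martingale_transform k om) (a k om) (b k om) sh.
    have h0' : 0 <= h := ltW h0.
    rewrite -[4%N]/(2 * 2)%N exprM sqr_sqrtr// => /le_trans; apply.
    rewrite -EFinD lee_fin -addrA lerD2l; apply: lerD.
      by rewrite ler_wpM2r// ler_wpM2l.
    by rewrite ler_wpM2r ?sqr_ge0// ler_wpM2l.
rewrite ge0_integralD//=.
- by rewrite integral_cst//= [P _]probability_setT mule1.
- by move=> om _; rewrite lee_fin sqr_ge0.
- by apply/measurable_EFinP; exact: measurable_funX.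
Qed.

Lemma martingale_transform_bound k :
  (\int[P]_om (martingale_transform k om ^+ 2)%:E <=
   (k%:R * (2 * A * h + 258 * B * h ^+ 2))%:E)%E.
Proof.
elim: k => [|k IHk].
  rewrite integral0_eq ?mul0r// => om _.
  by rewrite /martingale_transform big_ord0 expr0n.
apply: le_trans (martingale_transform_step k) _.
by rewrite -[k.+1%:R]natr1 (mulrDl k%:R) mul1r (EFinD (k%:R * _)); exact: leeD.
Qed.

End MartingaleTransform.
End BrownianIncrements.

(** * The Lyapunov function *)

Lemma cvg_sum (R : realType) (T I : Type) (F : set_system T) (r : seq I) (Q : pred I)
    (f : I -> T -> R) (l : I -> R) : Filter F ->
  (forall i, Q i -> f i t @[t --> F] --> l i) ->
  \sum_(i <- r | Q i) f i t @[t --> F] --> \sum_(i <- r | Q i) l i.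
Proof.
move=> FF fl; elim: r => [|i r IH].
  rewrite big_nil (_ : (fun t => _) = cst 0); first exact: cvg_cst.
  by apply/funext => t; rewrite big_nil.
rewrite big_cons (_ : (fun t => _) = (fun t => if Q i
  then f i t + \sum_(i <- r | Q i) f i t else \sum_(i <- r | Q i) f i t)).
  by case: ifPn => // Qi; apply: cvgD => //; exact: fl.
by apply/funext => t; rewrite big_cons.
Qed.

(** * The correction attached to a single distance *)

Section Profile.
Variable R : realType.
Implicit Types e g : R.

(* [profile e] is at most [e] and has slope 1 at 0 and a small slope elsewhere.
   Being a Moebius function, it satisfies a second-order Taylor inequality
   without remainder, [profile_taylor].  The absolute values only serve to make
   [profile_slope] and [profile_bend] continuous on the whole line. *)
Definition profile e g : R := e * g / (e + g).
Definition profile_slope e g : R := (e / (e + `|g|)) ^+ 2.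
Definition profile_bend e g : R := e / (e + `|g|) ^+ 2.

Lemma profile_taylor e a b : 0 < e -> 0 <= a -> 0 <= b ->
  profile_slope e a * (b - a) - profile_bend e a * (b - a) ^+ 2 <=
  profile e b - profile e a.
Proof.
move=> e0 a0 b0; rewrite /profile_slope /profile_bend /profile ger0_norm//.
have ea : e + a != 0 by rewrite gt_eqF// ltr_wpDr.
have eb : e + b != 0 by rewrite gt_eqF// ltr_wpDr.
rewrite -subr_ge0 (_ : _ - _ = e * b * (b - a) ^+ 2 / ((e + a) ^+ 2 * (e + b))).
  have e0' := ltW e0; apply: divr_ge0; apply: mulr_ge0; rewrite ?sqr_ge0 ?addr_ge0//.
  exact: mulr_ge0.
by field; rewrite ea eb.
Qed.

Lemma profile_ge0 e g : 0 < e -> 0 <= g -> 0 <= profile e g.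
Proof. by move=> e0 g0; rewrite divr_ge0 ?mulr_ge0 ?addr_ge0 ?(ltW e0). Qed.

Lemma profile_le e g : 0 < e -> 0 <= g -> profile e g <= e.
Proof.
move=> e0 g0; rewrite /profile ler_pdivrMr ?ltr_wpDr//.
by rewrite ler_wpM2l ?(ltW e0)// lerDr ltW.
Qed.

Lemma profile_slope_ge0 e g : 0 <= profile_slope e g.
Proof. exact: sqr_ge0. Qed.

Lemma profile_slope0 e : 0 < e -> profile_slope e 0 = 1.
Proof. by move=> e0; rewrite /profile_slope normr0 addr0 divff ?expr1n ?gt_eqF. Qed.

Lemma profile_slope_le1 e g : 0 < e -> profile_slope e g <= 1.
Proof.
move=> e0; rewrite /profile_slope exprn_ile1//.
  by rewrite divr_ge0 ?addr_ge0 ?(ltW e0).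
by rewrite ler_pdivrMr ?mul1r ?lerDl// ltr_wpDr.
Qed.

Lemma profile_slope1_le e : 0 < e -> e <= 1 -> profile_slope e 1 <= 4^-1.
Proof.
move=> e0 e1; rewrite /profile_slope normr1.
rewrite (_ : 4^-1 = (2^-1) ^+ 2 :> R); last by field.
rewrite lerXn2r// ?nnegrE ?divr_ge0 ?addr_ge0 ?(ltW e0)//.
by rewrite ler_pdivrMr ?ltr_wpDr//; lra.
Qed.

Lemma profile_slopeN e g : profile_slope e (- g) = profile_slope e g.
Proof. by rewrite /profile_slope normrN. Qed.

Lemma profile_bendN e g : profile_bend e (- g) = profile_bend e g.
Proof. by rewrite /profile_bend normrN. Qed.

Lemma profile_bend_ge0 e g : 0 < e -> 0 <= profile_bend e g.
Proof. by move=> e0; rewrite divr_ge0 ?sqr_ge0 ?(ltW e0). Qed.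

Lemma profile_bend_le e g : 0 < e -> profile_bend e g <= e^-1.
Proof.
move=> e0; have eg : 0 < e + `|g| by rewrite ltr_wpDr.
rewrite /profile_bend ler_pdivrMr ?exprn_gt0//.
rewrite -(ler_pM2l e0) mulrA divff ?gt_eqF// mul1r -expr2.
by rewrite lerXn2r ?nnegrE ?lerDl// ltW.
Qed.

(** Uniform in [e], hence usable for domination as [e] tends to 0; [profile_bend_le] serves for
    fixed [e]. *)
Lemma profile_bend_leV e g : 0 < e -> 0 < g -> profile_bend e g <= g^-1.
Proof.
move=> e0 g0; have eg : 0 < e + g by rewrite addr_gt0.
rewrite /profile_bend gtr0_norm// ler_pdivrMr ?exprn_gt0//.
rewrite -(ler_pM2l g0) mulrA divff ?gt_eqF// mul1r; nra.
Qed.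

Lemma profile_bend_le_inv e g : 0 < e -> g != 0 -> profile_bend e g <= (`|g|)^-1.
Proof.
move=> e0 g0; rewrite -[profile_bend e g]/(e / (e + `|g|) ^+ 2).
by have := @profile_bend_leV e `|g| e0; rewrite /profile_bend normr_id normr_gt0; exact.
Qed.

Lemma profile_bend_le_div e g : 0 < e -> g != 0 -> profile_bend e g <= e / g ^+ 2.
Proof.
move=> e0 g0; have g20 : 0 < g ^+ 2 by rewrite exprn_even_gt0.
have eg : 0 < e + `|g| by rewrite ltr_wpDr.
rewrite ler_wpM2l ?(ltW e0)// lef_pV2 ?posrE ?(exprn_gt0 _ eg)//.
by rewrite -real_normK ?num_real// lerXn2r ?nnegrE ?(ltW eg)// lerDr ltW.
Qed.

Lemma profile_slope_bend e g : profile_slope e g = e * profile_bend e g.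
Proof. by rewrite /profile_slope /profile_bend expr_div_n expr2 mulrA. Qed.

End Profile.

(** * The corrected energy and its Taylor inequality *)

Section Lyapunov.
Variables (R : realType) (N : nat).
Implicit Types (x a b : 'rV[R]_N) (e : R).
Local Notation u := (N.+1%:R^-1 : R).
Local Notation A := (2 * N%:R : R).

(* [order_sign i j] is the sign of [x^i - x^j] in the ordered chamber. *)
Definition order_sign (i j : 'I_N) : R := (j < i)%N%:R - (i < j)%N%:R.

Definition ordered x :=
  (forall i, 0 <= x$i <= 1) /\ (forall i j : 'I_N, (i < j)%N -> x$i <= x$j).

(* Reflection at [x^k = x^(k+1)] meets a gradient whose pair terms cancel except
   for that of the colliding pair; at the boundary the weight [A] outweighs the
   at most [N] pair terms. *)
Definition lyapunov e x : R :=
  \sum_(i < N) ((x$i - i.+1%:R * u) ^+ 2 / 2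
          + A * (profile e x$i + profile e (1 - x$i)))
  + \sum_(i < N) \sum_(j < N) (i < j)%N%:R * profile e (x$j - x$i).

(** The partial derivative of [lyapunov] on ordered configurations; since [profile_slope] is even,
    [order_sign] alone records the orientation of a pair. *)
Definition lyapunov_grad e x (i : 'I_N) : R :=
  x$i - i.+1%:R * u
  + A * (profile_slope e x$i - profile_slope e (1 - x$i))
  + \sum_(j < N) order_sign i j * profile_slope e (x$i - x$j).

(** A diagonal bound for the loss of second order. The factor 2 on the pairs comes from
    [(v_j - v_i)^2 <= 2 v_i^2 + 2 v_j^2], which decouples the coordinates. *)
Definition lyapunov_bend e x (i : 'I_N) : R :=
  A * (profile_bend e x$i + profile_bend e (1 - x$i))
  + 2 * \sum_(j < N | j != i) profile_bend e (x$i - x$j).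

Lemma pair_sum_taylor e a b : 0 < e -> ordered a -> ordered b ->
  \sum_(i < N) ((\sum_(j < N) order_sign i j * profile_slope e (a$i - a$j)) * (b$i - a$i)
    - 2 * (\sum_(j < N | j != i) profile_bend e (a$i - a$j)) * (b$i - a$i) ^+ 2)
  <= \sum_(i < N) \sum_(j < N) (i < j)%N%:R * profile e (b$j - b$i)
     - \sum_(i < N) \sum_(j < N) (i < j)%N%:R * profile e (a$j - a$i).
Proof.
move=> e0 [_ oa] [_ ob].
pose S (i j : 'I_N) := (i < j)%N%:R * profile_slope e (a$j - a$i).
pose H (i j : 'I_N) := (i < j)%N%:R * profile_bend e (a$j - a$i).
pose v i := b$i - a$i.
have sumD (f g : 'I_N -> 'I_N -> R) : \sum_(i < N) \sum_(j < N) (f i j + g i j) =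
    \sum_(i < N) \sum_(j < N) f i j + \sum_(i < N) \sum_(j < N) g i j.
  by rewrite -big_split; apply: eq_bigr => i _; rewrite big_split.
have sumB (f g : 'I_N -> 'I_N -> R) : \sum_(i < N) \sum_(j < N) (f i j - g i j) =
    \sum_(i < N) \sum_(j < N) f i j - \sum_(i < N) \sum_(j < N) g i j.
  by rewrite -sumrB; apply: eq_bigr => i _; rewrite sumrB.
(* The sums over coordinates are regrouped as sums over pairs [i < j] by exchanging indices;
   [profile_taylor] then applies pair by pair. *)
apply: (@le_trans _ _ (\sum_(i < N) \sum_(j < N)
  (S i j * (v j - v i) - 2 * H i j * (v i ^+ 2 + v j ^+ 2)))).
  rewrite le_eqVlt; apply/orP; left; apply/eqP.
  have E1 : \sum_(i < N) (\sum_(j < N) order_sign i j * profile_slope e (a$i - a$j)) * v i =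
      \sum_(i < N) \sum_(j < N) S i j * (v j - v i).
    transitivity (\sum_(i < N) \sum_(j < N) (S j i * v i - S i j * v i)).
      apply: eq_bigr => i _; rewrite mulr_suml; apply: eq_bigr => j _.
      rewrite /S /order_sign mulrBl mulrBl; congr (_ - _).
      by rewrite -[a$j - a$i]opprB profile_slopeN.
    rewrite sumB exchange_big/= -sumB.
    by apply: eq_bigr => i _; apply: eq_bigr => j _; rewrite [RHS]mulrBr.
  have E2 : \sum_(i < N) 2 * (\sum_(j < N | j != i) profile_bend e (a$i - a$j)) * v i ^+ 2 =
      \sum_(i < N) \sum_(j < N) 2 * H i j * (v i ^+ 2 + v j ^+ 2).
    transitivity (\sum_(i < N) \sum_(j < N) (2 * H i j * v i ^+ 2 + 2 * H j i * v i ^+ 2)).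
      apply: eq_bigr => i _; rewrite big_mkcond mulr_sumr mulr_suml; apply: eq_bigr => j _.
      rewrite -mulrDl -mulrDr; congr (_ * _ * _); rewrite /H.
      have [ij|ji|/val_inj ->] := ltngtP i j; last by rewrite eqxx !mul0r addr0.
      - rewrite mul0r mul1r addr0 -[a$j - a$i]opprB profile_bendN.
        by case: eqVneq ij => // ->; rewrite ltnn.
      - rewrite mul0r mul1r add0r.
        by case: eqVneq ji => // ->; rewrite ltnn.
    rewrite sumD [X in _ + X]exchange_big/= -sumD.
    by apply: eq_bigr => i _; apply: eq_bigr => j _; rewrite [RHS]mulrDr.
  by rewrite sumrB E1 E2 sumB.
rewrite -sumrB; apply: ler_sum => i _; rewrite -sumrB; apply: ler_sum => j _.
rewrite /S /H -mulrBr; case: (ltnP i j) => [ij|_]; last by rewrite !(mul0r, mulr0) subr0.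
rewrite !mul1r.
have aij : 0 <= a$j - a$i by rewrite subr_ge0 oa.
have bij : 0 <= b$j - b$i by rewrite subr_ge0 ob.
apply: le_trans (profile_taylor e0 aij bij).
rewrite (_ : b$j - b$i - (a$j - a$i) = v j - v i); last by rewrite /v; ring.
(* [2 (p^2 + q^2) - (q - p)^2 = (p + q)^2], the slack left by decoupling the two coordinates. *)
have := mulr_ge0 (profile_bend_ge0 (a$j - a$i) e0) (sqr_ge0 (v j + v i)).
by rewrite lerD2l; move: (profile_bend _ _) (v i) (v j) => h p q; lra.
Qed.

Lemma lyapunov_taylor e a b : 0 < e -> ordered a -> ordered b ->
  \sum_(i < N) (lyapunov_grad e a i * (b$i - a$i)
          + (2^-1 - lyapunov_bend e a i) * (b$i - a$i) ^+ 2)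
  <= lyapunov e b - lyapunov e a.
Proof.
move=> e0 oa ob; rewrite /lyapunov opprD addrACA.
apply: le_trans (lerD (lexx _) (pair_sum_taylor e0 oa ob)).
rewrite -sumrB -big_split; apply: ler_sum => i _ /=.
have /andP[ai0 ai1] := oa.1 i; have /andP[bi0 bi1] := ob.1 i.
have t1 := profile_taylor e0 ai0 bi0.
have t2 : profile_slope e (1 - a$i) * (1 - b$i - (1 - a$i)) -
    profile_bend e (1 - a$i) * (1 - b$i - (1 - a$i)) ^+ 2
    <= profile e (1 - b$i) - profile e (1 - a$i).
  by apply: profile_taylor => //; rewrite subr_ge0.
have A0 : 0 <= A by rewrite mulr_ge0.
have := ler_wpM2l A0 (lerD t1 t2).
rewrite /lyapunov_grad /lyapunov_bend.
set S := \sum_(j < N) _; set H := \sum_(j | _) _.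
set s1 := profile_slope _ _; set s2 := profile_slope _ _.
set h1 := profile_bend _ _; set h2 := profile_bend _ _.
set p1 := profile e _; set p2 := profile e _; set p3 := profile e _; set p4 := profile e _.
by move: (i.+1%:R * u) => z; lra.
Qed.

End Lyapunov.

(** * The ordered chamber *)

Section Chamber.
Variables (R : realType) (N : nat).
Implicit Types (x : 'rV[R]_N) (e : R) (f : 'I_N -> R).
Local Notation u := (N.+1%:R^-1 : R).

(* Same indexing as [pt], with boundary values [0] and [v]. *)
Definition extend (v : R) f (k : nat) : R :=
  if k is j.+1 then (if insub j is Some i then f i else v) else 0.

Lemma ptE x k : pt x k = extend 1 (fun i => x$i) k. Proof. by []. Qed.

Lemma extendS v f (i : 'I_N) : extend v f i.+1 = f i.
Proof. by rewrite /extend valK. Qed.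

Lemma extend_last v f : extend v f N.+1 = v.
Proof. by rewrite /extend insubF// ltnn. Qed.

(** Each local time [l^k] acts on two neighbouring coordinates; collecting its contributions leaves
    a jump of [f] across [k]. The value 0 at both ends of [extend] accounts for the walls, which do
    not move. *)
Lemma summation_by_parts f (L : 'I_N.+1 -> R) :
  \sum_(i < N) f i * (L (widen_ord (leqnSn N) i) - L (lift ord0 i)) =
  \sum_(k < N.+1) (extend 0 f k.+1 - extend 0 f k) * L k.
Proof.
under eq_bigr do rewrite mulrBr; under [RHS]eq_bigr do rewrite mulrBl.
rewrite !sumrB; congr (_ - _).
  rewrite [RHS]big_ord_recr/= [insub N]insubF ?ltnn// mul0r addr0.
  by apply: eq_bigr => i _; rewrite valK.
rewrite [RHS]big_ord_recl/= mul0r add0r.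
by apply: eq_bigr => i _; rewrite add0n valK.
Qed.

Lemma pt_continuous k : continuous (fun x => pt x k).
Proof.
case: k => [|k]; rewrite /pt; first exact: cst_continuous.
by case: insub => [i|]; [exact: coord_continuous|exact: cst_continuous].
Qed.

Lemma closure_Sigma_pt_le x k : closure (@Sigma R N) x -> (k <= N)%N -> pt x k <= pt x k.+1.
Proof.
move=> xS kN.
have cl : closed [set y : 'rV[R]_N | pt y k <= pt y k.+1].
  rewrite (_ : [set y | _] = (fun y : 'rV[R]_N => pt y k.+1 - pt y k) @^-1` [set t | 0 <= t]).
    apply: closed_comp; last exact: closed_ge.
    by move=> y _; exact: (cvgB (@pt_continuous k.+1 y) (@pt_continuous k y)).
  by apply/seteqP; split => y /=; rewrite subr_ge0.
suff /(_ x xS) : closure (@Sigma R N) `<=` [set y | pt y k <= pt y k.+1] by [].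
by move/closure_id: cl => ->; apply: closure_subset => y /(_ k kN)/ltW.
Qed.

Lemma pt_le_chain x : (forall k, (k <= N)%N -> pt x k <= pt x k.+1) ->
  forall i j, (i <= j)%N -> (j <= N.+1)%N -> pt x i <= pt x j.
Proof.
move=> xS i j; elim: j => [|j IH]; first by rewrite leqn0 => /eqP ->.
rewrite leq_eqVlt => /predU1P[-> //|ij] jN.
by apply: le_trans (xS _ _) => //; apply: IH => //; exact: leqW.
Qed.

Lemma closure_Sigma_ordered x : closure (@Sigma R N) x -> ordered x.
Proof.
move=> xS; have ch := pt_le_chain (fun k => @closure_Sigma_pt_le x k xS).
split=> [i|i j ij].
  have := ch 0%N i.+1 isT (leqW (ltn_ord i)); have := ch i.+1 N.+1 (leqW (ltn_ord i)) (leqnn _).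
  by rewrite !ptE extendS extend_last /= => -> ->.
have := ch i.+1 j.+1 (leqW ij) (leqW (ltn_ord j)).
by rewrite !ptE !extendS.
Qed.

Lemma normr_interaction_le e x (i : 'I_N) : 0 < e ->
  `|\sum_(j < N) order_sign R i j * profile_slope e (x$i - x$j)| <= N%:R.
Proof.
move=> e0; apply: le_trans (ler_norm_sum _ _ _) _.
rewrite -[in leRHS](card_ord N) -sumr_const; apply: ler_sum => j _.
rewrite normrM (ger0_norm (profile_slope_ge0 _ _)).
rewrite -[leRHS]mulr1 ler_pM ?profile_slope_ge0 ?profile_slope_le1//.
rewrite /order_sign; case: ltngtP => _; rewrite ?subr0 ?sub0r ?normrN ?normr1 ?normr0//.
Qed.

(** The near wall contributes [2 N], the far wall at least [-2 N / 4], the pairs at least [-N], and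
    the deviation is [-1/(N+1) >= -1/2]; the total is nonnegative since [N >= 1]. *)
Lemma lyapunov_grad_first e x (i : 'I_N) : 0 < e -> e <= 1 ->
  val i = 0%N -> x$i = 0 -> 0 <= lyapunov_grad e x i.
Proof.
move=> e0 e1 i0 xi; have N1 : 1 <= N%:R :> R by rewrite ler1n (leq_trans _ (ltn_ord i)).
have uN : u * (N%:R + 1) = 1 by rewrite natr1 mulVf// pnatr_eq0.
have u0 : 0 <= u by rewrite invr_ge0.
have := normr_interaction_le x i e0; rewrite /lyapunov_grad xi i0.
rewrite ler_norml => /andP[+ _]; set S := \sum_(j < N) _.
rewrite subr0 profile_slope0// mul1r; have := profile_slope1_le e0 e1.
by move: (profile_slope _ _) u S uN u0 => p v S; nra.
Qed.

Lemma lyapunov_grad_last e x (i : 'I_N) : 0 < e -> e <= 1 ->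
  (val i).+1 = N -> x$i = 1 -> lyapunov_grad e x i <= 0.
Proof.
move=> e0 e1 iN xi; have N1 : 1 <= N%:R :> R by rewrite ler1n (leq_trans _ (ltn_ord i)).
have uN : u * (N%:R + 1) = 1 by rewrite natr1 mulVf// pnatr_eq0.
have u0 : 0 <= u by rewrite invr_ge0.
have := normr_interaction_le x i e0; rewrite /lyapunov_grad xi iN.
rewrite ler_norml => /andP[_ +]; set S := \sum_(j < N) _.
rewrite subrr profile_slope0//; have := profile_slope1_le e0 e1.
by move: (profile_slope _ _) u S uN u0 => p v S; nra.
Qed.

(** At equal positions the wall terms agree and the deviation loses [u <= 1], which the pair [i, j]
    compensates with slope 1 at distance 0. *)
Lemma lyapunov_grad_middle e x (i j : 'I_N) : 0 < e ->
  val j = (val i).+1 -> x$i = x$j -> lyapunov_grad e x i <= lyapunov_grad e x j.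
Proof.
move=> e0 ji xij; rewrite /lyapunov_grad xij ji.
have u0 : u <= 1 by rewrite invf_le1// ler1n.
suff : 1 <= \sum_(k < N) order_sign R j k * profile_slope e (x$j - x$k)
          - \sum_(k < N) order_sign R i k * profile_slope e (x$j - x$k).
  rewrite -[(\val i).+2%:R]natr1 -[\val i]/(nat_of_ord i).
  move: (\sum_(k < N) order_sign R j k * _) (\sum_(k < N) order_sign R i k * _) => S S' SS'.
  rewrite -subr_ge0 [X in 0 <= X](_ : _ = S - S' - u) ?subr_ge0 ?(le_trans u0)//.
  by ring.
rewrite -sumrB (bigD1 i)//= xij subrr profile_slope0// -[leLHS]addr0.
(* Any other [k] lies on the same side of [i] and of its successor [j], so its two signs cancel. *)
have os k : order_sign R j k - order_sign R i k = (k == i)%:R + (k == j)%:R.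
  have ji' : nat_of_ord j = i.+1 by [].
  rewrite /order_sign -!(inj_eq val_inj) -![\val _]/(nat_of_ord _) ji' ltnS.
  move: (nat_of_ord k) (nat_of_ord i) => a b.
  have [ab|ba|->] := ltngtP a b.
  - have -> : (b.+1 < a)%N = false by lia.
    have -> : (a == b.+1) = false by lia.
    by rewrite /=; lra.
  - have -> : (a == b.+1) = ~~ (b.+1 < a)%N by lia.
    by case: (b.+1 < a)%N => /=; lra.
  - have -> : (b.+1 < b)%N = false by lia.
    have -> : (b == b.+1) = false by lia.
    by rewrite /=; lra.
apply: lerD.
  by rewrite -mulrBl os eqxx mulr1 lerDl.
apply: sumr_ge0 => k _; rewrite -mulrBl os mulr_ge0 ?profile_slope_ge0// addr_ge0//.
Qed.

Lemma lyapunov_grad_boundary e x (k : nat) : 0 < e -> e <= 1 -> (k <= N)%N ->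
  pt x k = pt x k.+1 ->
  extend 0 (lyapunov_grad e x) k <= extend 0 (lyapunov_grad e x) k.+1.
Proof.
move=> e0 e1; case: k => [_|k kN] /=.
  by case: insubP => [i _ i0 xi|_ //]; exact: lyapunov_grad_first.
rewrite insubT/=; case: insubP => [j _ jk xij|kN' xi].
  exact: lyapunov_grad_middle.
by apply: lyapunov_grad_last => //=; apply/eqP; rewrite eqn_leq kN leqNgt.
Qed.

End Chamber.

(** * Bounds uniform in [e], and the limit at interior configurations *)

Section ChamberInterior.
Variables (R : realType) (N : nat).
Implicit Types (x : 'rV[R]_N) (e : R).
Local Notation u := (N.+1%:R^-1 : R).
Local Notation gap x k := (pt x k.+1 - pt x k).

Lemma normr_lyapunov_grad_le e x (i : 'I_N) : 0 < e -> ordered x ->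
  `|lyapunov_grad e x i| <= 4 * N%:R + 1.
Proof.
move=> e0 [/(_ i)/andP[x0 x1] _].
have := normr_interaction_le x i e0; rewrite /lyapunov_grad.
set S := \sum_(j < N) _; rewrite !ler_norml => /andP[S0 S1].
have := profile_slope_le1 x$i e0; have := profile_slope_le1 (1 - x$i) e0.
have := profile_slope_ge0 e x$i; have := profile_slope_ge0 e (1 - x$i).
move: (profile_slope _ _) (profile_slope _ _) => p q p0 q0 p1 q1.
have v0 : 0 <= i.+1%:R * u by rewrite mulr_ge0.
have v1 : i.+1%:R * u <= 1 by rewrite ler_pdivrMr// mul1r ler_nat ltnW// ltnS.
have N0 : 0 <= N%:R :> R by [].
by move: (_ * u) (N%:R : R) N0 S S0 S1 v0 v1 => v n n0 S S0 S1 v0 v1; apply/andP; split; nra.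
Qed.

Lemma lyapunov_bend_ge0 e x (i : 'I_N) : 0 < e -> 0 <= lyapunov_bend e x i.
Proof.
move=> e0; rewrite addr_ge0// mulr_ge0// ?addr_ge0 ?profile_bend_ge0//.
by apply: sumr_ge0 => j _; exact: profile_bend_ge0.
Qed.

Lemma lyapunov_bend_le e c x (i : 'I_N) : 0 <= c ->
  profile_bend e x$i <= c -> profile_bend e (1 - x$i) <= c ->
  (forall j, j != i -> profile_bend e (x$i - x$j) <= c) ->
  lyapunov_bend e x i <= 6 * N%:R * c.
Proof.
move=> c0 b0 b1 b; rewrite /lyapunov_bend.
have S : \sum_(j < N | j != i) profile_bend e (x$i - x$j) <= N%:R * c.
  apply: (@le_trans _ _ (\sum_(j < N) c)); last by rewrite sumr_const card_ord mulr_natl.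
  by rewrite big_mkcond; apply: ler_sum => j _; case: ifPn => // /b.
have N0 : 0 <= N%:R :> R by [].
have := ler_wpM2l N0 (lerD b0 b1); move: (\sum_(j < N | _) _) S => S.
by lra.
Qed.

Lemma lyapunov_bend_bound e x (i : 'I_N) : 0 < e -> lyapunov_bend e x i <= 6 * N%:R * e^-1.
Proof.
move=> e0; have e1 : 0 <= e^-1 by rewrite invr_ge0 ltW.
by apply: lyapunov_bend_le => // *; exact: profile_bend_le.
Qed.

Lemma lyapunov_ge0 e x : 0 < e -> ordered x -> 0 <= lyapunov e x.
Proof.
move=> e0 [x01 xo]; apply: addr_ge0.
  apply: sumr_ge0 => i _; have /andP[x0 x1] := x01 i.
  apply: addr_ge0; first by rewrite divr_ge0 ?sqr_ge0.
  by apply: mulr_ge0; rewrite ?mulr_ge0// addr_ge0 ?profile_ge0 ?subr_ge0.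
apply: sumr_ge0 => i _; apply: sumr_ge0 => j _.
case: ltnP => [ij|_]; last by rewrite mul0r.
by rewrite mul1r profile_ge0 ?subr_ge0 ?xo.
Qed.

Lemma lyapunov_le e x : 0 < e -> e <= 1 -> ordered x ->
  lyapunov e x <= N%:R * (5 * N%:R + 1).
Proof.
move=> e0 e1 [x01 xo].
have N0 : 0 <= N%:R :> R by [].
apply: (@le_trans _ _ (\sum_(i < N) (1 + 2 * N%:R * 2) + \sum_(i < N) \sum_(j < N) 1)).
  apply: lerD; apply: ler_sum => i _; last first.
    apply: ler_sum => j _; case: ltnP => [ij|_]; last by rewrite mul0r.
    by rewrite mul1r (le_trans _ e1)// profile_le ?subr_ge0 ?xo.
  have /andP[x0 x1] := x01 i.
  have p1 : profile e x$i <= 1 by rewrite (le_trans _ e1)// profile_le.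
  have p2 : profile e (1 - x$i) <= 1 by rewrite (le_trans _ e1)// profile_le ?subr_ge0.
  have v0 : 0 <= i.+1%:R * u by rewrite mulr_ge0.
  have v1 : i.+1%:R * u <= 1 by rewrite ler_pdivrMr// mul1r ler_nat ltnW// ltnS.
  apply: lerD; last by apply: ler_wpM2l; rewrite ?mulr_ge0//; lra.
  by move: (_ * u) v0 v1 => v v0 v1; nra.
rewrite !sumr_const !card_ord -[X in X + _]mulr_natl -[X in _ + X]mulr_natl; lra.
Qed.

Section Interior.
Variable x : 'rV[R]_N.
Hypothesis xS : Sigma x.

Lemma gap_gt0 k : (k <= N)%N -> 0 < gap x k.
Proof. by move=> kN; rewrite subr_gt0 xS. Qed.

Lemma sum_gap : \sum_(k < N.+1) gap x k = 1.
Proof.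
rewrite -(big_mkord xpredT (fun k => gap x k)) telescope_sumr// ptE extend_last.
by rewrite subr0.
Qed.

(* Convexity of the reciprocal: the equally spaced configuration minimises the
   sum of the inverse gaps. *)
Lemma drift_attraction_le0 :
  \sum_(i < N) (x$i - i.+1%:R * u) * drift x i <= 0.
Proof.
pose L (k : 'I_N.+1) := (gap x k)^-1.
have -> : \sum_(i < N) (x$i - i.+1%:R * u) * drift x i =
    \sum_(i < N) (x$i - i.+1%:R * u) * (L (widen_ord (leqnSn N) i) - L (lift ord0 i)).
  by apply: eq_bigr => i _; rewrite /L /drift lift0.
rewrite summation_by_parts.
have ext k : (k <= N.+1)%N ->
    extend 0 (fun i : 'I_N => x$i - i.+1%:R * u) k = pt x k - k%:R * u.
  case: k => [_|k kN]; first by rewrite /= mul0r subr0.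
  rewrite ptE /extend; case: insubP => [i _ <- //|].
  rewrite -leqNgt => Nk; have -> : k = N by apply/eqP; rewrite eqn_leq Nk -ltnS kN.
  by rewrite mulfV ?subrr// pnatr_eq0.
have u0 : 0 < u by rewrite invr_gt0.
(* Termwise [(g - u) / g <= (g - u) / u], and the right-hand sides sum to 0 because the gaps sum to
   1. *)
apply: (@le_trans _ _ (\sum_(k < N.+1) (gap x k / u - 1))).
  apply: ler_sum => k _; have kN : (k <= N)%N by rewrite -ltnS.
  rewrite !ext//; last exact: ltnW.
  rewrite /L; have := gap_gt0 kN.
  rewrite (_ : pt x k.+1 - k.+1%:R * u - (pt x k - k%:R * u) = gap x k - u); last first.
    by rewrite -(natr1 k); ring.
  move: (gap x k) => g g0; rewrite -subr_ge0.
  rewrite (_ : _ - _ = (g - u) ^+ 2 / (g * u)); first by rewrite divr_ge0 ?sqr_ge0 ?mulr_ge0 ?ltW.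
  by field; rewrite !gt_eqF.
rewrite sumrB -mulr_suml sum_gap sumr_const card_ord mul1r invrK subrr//.
Qed.

(** A common bound for all inverse gaps, made of the drift brackets so that it inherits their
    integrability in time. *)
Definition crowding : R := N.+1%:R + \sum_(j < N) `|drift x j|.

Lemma crowding_ge0 : 0 <= crowding.
Proof. by rewrite addr_ge0// sumr_ge0. Qed.

(* Some gap is at least [1 / N.+1], and consecutive inverse gaps differ by a
   drift bracket. *)
Lemma inv_gap_le k : (k <= N)%N -> (gap x k)^-1 <= crowding.
Proof.
have [k0 k0P] : exists k0 : 'I_N.+1, u <= gap x k0.
  apply/existsP; apply: contraT => /existsPn nk.
  have : \sum_(k < N.+1) gap x k < \sum_(k < N.+1) u.
    apply: ltr_sum; first by apply/hasP; exists ord0 => //; rewrite mem_index_enum.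
    by move=> j _; rewrite ltNge.
  by rewrite sum_gap sumr_const card_ord -[X in _ < X]mulr_natl mulfV ?ltxx// pnatr_eq0.
pose L m := (gap x m)^-1.
have Lk0 : L k0 <= N.+1%:R.
  rewrite /L -[leRHS]invrK lef_pV2// posrE ?invr_gt0// gap_gt0// -ltnS//.
have step m n : (m <= n)%N -> (n <= N)%N -> `|L n - L m| <= \sum_(j < N) `|drift x j|.
  move=> mn nN; rewrite -telescope_sumr//.
  apply: le_trans (ler_norm_sum _ _ _) _.
  pose D j := `|L j.+1 - L j|.
  rewrite (_ : \sum_(j < N) _ = \sum_(0 <= j < N) D j); last first.
    by rewrite big_mkord; apply: eq_bigr => j _; rewrite /D distrC.
  rewrite (big_cat_nat (leq0n m) (leq_trans mn nN))/=.
  by rewrite (big_cat_nat mn nN)/= addrCA lerDl addr_ge0// sumr_ge0// => j _; exact: normr_ge0.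
move=> kN; rewrite -/(L k) /crowding -(subrK (L k0) (L k)) addrC; apply: lerD => //.
apply: le_trans (ler_norm _) _.
have [kk|kk] := leqP k k0.
  by rewrite distrC; apply: step => //; rewrite -ltnS.
by apply: step => //; exact: ltnW.
Qed.

Lemma pt_sub_ge_gap i j : (i < j)%N -> (j <= N.+1)%N -> gap x i <= pt x j - pt x i.
Proof.
move=> ij jN; rewrite lerD2r; apply: pt_le_chain => // k kN.
exact/ltW/xS.
Qed.

Lemma inv_pt_sub_le i j : (i < j)%N -> (j <= N.+1)%N ->
  0 < pt x j - pt x i /\ (pt x j - pt x i)^-1 <= crowding.
Proof.
move=> ij jN; have iN : (i <= N)%N by rewrite -ltnS (leq_trans ij).
have g0 := gap_gt0 iN; have gj := pt_sub_ge_gap ij jN.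
have pj := lt_le_trans g0 gj; split => //.
by apply: le_trans (inv_gap_le iN); rewrite lef_pV2.
Qed.

Lemma coord_sub_neq0 (i j : 'I_N) : j != i ->
  x$i - x$j != 0 /\ (`|x$i - x$j|)^-1 <= crowding.
Proof.
have key (k l : 'I_N) : (k < l)%N -> x$k - x$l != 0 /\ (`|x$k - x$l|)^-1 <= crowding.
  move=> kl; have [] := @inv_pt_sub_le k.+1 l.+1 kl (leqW (ltn_ord l)).
  rewrite !ptE !extendS => p0 p1.
  by rewrite distrC (gtr0_norm p0) -oppr_eq0 opprB gt_eqF.
rewrite -(inj_eq val_inj) neq_ltn => /orP[ji|/key//].
by rewrite distrC -oppr_eq0 opprB; exact: key.
Qed.

Lemma coord_gt0 (i : 'I_N) : 0 < x$i /\ (x$i)^-1 <= crowding.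
Proof.
have [] := @inv_pt_sub_le 0 i.+1 isT (leqW (ltn_ord i)).
by rewrite !ptE extendS subr0.
Qed.

Lemma coord_lt1 (i : 'I_N) : 0 < 1 - x$i /\ (1 - x$i)^-1 <= crowding.
Proof.
have [] := @inv_pt_sub_le i.+1 N.+1 (ltn_ord i) (leqnn _).
by rewrite !ptE extendS extend_last.
Qed.

Lemma lyapunov_bend_le_crowding e (i : 'I_N) : 0 < e ->
  lyapunov_bend e x i <= 6 * N%:R * crowding.
Proof.
move=> e0; have [x0 xc] := coord_gt0 i; have [y0 yc] := coord_lt1 i.
apply: lyapunov_bend_le; first exact: crowding_ge0.
- by apply: le_trans (profile_bend_leV e0 x0) xc.
- by apply: le_trans (profile_bend_leV e0 y0) yc.
- by move=> j /coord_sub_neq0[n0 nc]; apply: le_trans (profile_bend_le_inv e0 n0) nc.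
Qed.

Local Notation eps n := (n.+1%:R^-1 : R).

Lemma profile_bend_cvg0 g : g != 0 -> profile_bend (eps n) g @[n --> \oo] --> (0 : R).
Proof.
move=> g0; apply: (@squeeze_cvgr _ _ _ _ (cst 0) (fun n => eps n / g ^+ 2)).
- near=> n; rewrite profile_bend_ge0 ?profile_bend_le_div ?invr_gt0//.
- exact: cvg_cst.
- by rewrite -[0 in X in _ --> X](mul0r (g ^+ 2)^-1); apply: cvgMl; exact: cvg_harmonic.
Unshelve. all: by end_near. Qed.

Lemma profile_slope_cvg0 g : g != 0 -> profile_slope (eps n) g @[n --> \oo] --> (0 : R).
Proof.
move=> g0; rewrite (_ : (fun n => _) = (fun n => eps n * profile_bend (eps n) g)); last first.
  by apply/funext => n; rewrite profile_slope_bend.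
rewrite -[0 in X in _ --> X](mul0r (0 : R)); apply: cvgM; first exact: cvg_harmonic.
exact: profile_bend_cvg0.
Qed.

Lemma lyapunov_bend_cvg0 (i : 'I_N) : lyapunov_bend (eps n) x i @[n --> \oo] --> (0 : R).
Proof.
have [x0 _] := coord_gt0 i; have [y0 _] := coord_lt1 i.
rewrite /lyapunov_bend.
rewrite [X in _ --> X](_ : 0 = 2 * N%:R * (0 + 0) + 2 * \sum_(j < N | j != i) 0); last first.
  by rewrite big1//; lra.
apply: cvgD; apply: cvgMr.
  by apply: cvgD; apply: profile_bend_cvg0; rewrite gt_eqF.
apply: cvg_sum => j ji; apply: profile_bend_cvg0.
by have [] := coord_sub_neq0 ji.
Qed.

Lemma lyapunov_grad_cvg (i : 'I_N) :
  lyapunov_grad (eps n) x i @[n --> \oo] --> x$i - i.+1%:R * u.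
Proof.
have [x0 _] := coord_gt0 i; have [y0 _] := coord_lt1 i.
rewrite /lyapunov_grad.
rewrite [X in _ --> X](_ : _ = x$i - i.+1%:R * u + 2 * N%:R * (0 - 0) + \sum_(j < N) 0); last first.
  by rewrite big1// subrr mulr0 !addr0.
apply: cvgD.
  apply: cvgD; first exact: cvg_cst.
  by apply: cvgMr; apply: cvgB; apply: profile_slope_cvg0; rewrite gt_eqF.
apply: cvg_sum => j _; have [->|ji] := eqVneq j i.
  rewrite (_ : (fun n => _) = cst 0); first exact: cvg_cst.
  by apply/funext => n; rewrite /order_sign subrr mul0r.
rewrite -[0 in X in _ --> X](mulr0 (order_sign R i j)); apply: cvgMr.
by apply: profile_slope_cvg0; have [] := coord_sub_neq0 ji.
Qed.

End Interior.
End ChamberInterior.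

(** * Paths and Riemann sums *)

Section PathLemmas.
Variable R : realType.
Implicit Types (f : R -> R).
Local Notation mu := (@lebesgue_measure R).

Lemma continuous_path_comp (U V : topologicalType) (f : R -> U) (g : U -> V) :
  continuous_path f -> continuous g -> continuous_path (g \o f).
Proof. move=> cf cg s; exact: (@continuous_comp (subspace _) U V f g s (cf s) (cg _)). Qed.

Lemma continuous_path_extension f : continuous_path f -> continuous (path_extension f).
Proof.
move=> cf x.
have pos (s : R) : `[0, +oo[%classic (Num.max 0 s).
  by rewrite /= in_itv /= andbT le_max lexx.
have /subspace_continuousP/(_ _ (pos x)) fx := cf.
apply: cvg_trans fx.
have cmax : (Num.max 0 s : R) @[s --> x] --> (Num.max 0 x : R).
  by apply: (@continuous_max R R (cst 0) id x) => //; exact: cvg_cst.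
move=> A fA; have := cmax _ fA; rewrite !nbhs_filterE /=.
by apply: filterS => s /= As; exact/As/pos.
Qed.

Lemma path_extensionE f (s : R) : 0 <= s -> path_extension f s = f s.
Proof. by move=> s0; rewrite /path_extension max_r. Qed.

Lemma measurable_path f (D : set R) : continuous_path f ->
  (forall s, D s -> 0 <= s) -> measurable D -> measurable_fun D f.
Proof.
move=> cf D0 mD; apply: (eq_measurable_fun (path_extension f)).
  by move=> s; rewrite inE => /D0 s0; rewrite path_extensionE.
apply: measurable_funTS; apply: continuous_measurable_fun.
exact: continuous_path_extension.
Qed.

Definition osc_le (h : R) (n : nat) (eta : R) f : Prop :=
  forall m (s : R), (m < n)%N -> m%:R * h <= s -> s <= m.+1%:R * h ->
    `|f s - f (m%:R * h)| <= eta.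

Lemma osc_le_near (t eta : R) f : 0 < t -> 0 < eta -> continuous_path f ->
  \forall n \near \oo, osc_le (t / n.+1%:R) n.+1 eta f.
Proof.
move=> t0 eta0 cf.
have cg := continuous_path_extension cf.
(* Uniform continuity on [[0, t]] by compactness, with the mesh as modulus. Working with
   [path_extension] allows [s'] to leave the interval. *)
pose Q (n : nat) (s : R) := forall s' : R, `|s' - s| <= t / n.+1%:R ->
  `|path_extension f s' - path_extension f s| <= eta.
have /compact_near_coveringP := @segment_compact R 0 t.
move=> /(_ nat \oo Q _) cov; have {}cov : \forall n \near \oo, `[0, t] `<=` Q n.
  apply: cov => x _.
  have eta2 : 0 < eta / 2 by rewrite divr_gt0.
  have /cvgrPdist_le/(_ _ eta2) := cg x; rewrite near_simpl => -[/= r r0 xr].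
  have r2 : 0 < r / 2 by rewrite divr_gt0.
  exists (ball x (r / 2), [set n | t / n.+1%:R < r / 2]).
    split; first exact: nbhsx_ballx.
    have : (fun n => t * n.+1%:R^-1) @ \oo --> t * 0.
      by apply: cvgMr; exact: cvg_harmonic.
    by rewrite mulr0 => /cvgr_lt/(_ _ r2).
  move=> [y n] /= [xy nr] s' ys.
  rewrite -(subrKA (path_extension f x)) (le_trans (ler_normD _ _))// (splitr eta).
  rewrite lerD//; first rewrite distrC; apply: xr => /=.
    rewrite -(subrKA y) (le_lt_trans (ler_normD _ _))// (splitr r) ltrD//.
    by rewrite distrC (le_lt_trans ys).
  by rewrite (lt_trans xy)// ltr_pdivrMr// ltr_pMr// ltr1n.
near=> n => m s mn ms sm.
have h0 : 0 < t / n.+1%:R by rewrite divr_gt0.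
have m0 : 0 <= m%:R * (t / n.+1%:R) by rewrite mulr_ge0// ltW.
have mt : m%:R * (t / n.+1%:R) <= t.
  by rewrite mulrCA ler_piMr ?(ltW t0)// ler_pdivrMr// mul1r ler_nat ltnW.
have : forall x, `[0, t]%classic x -> Q n x by near: n.
move=> /(_ (m%:R * (t / n.+1%:R))); rewrite /= in_itv/= m0 mt => /(_ isT s).
rewrite !path_extensionE ?(le_trans m0)//; apply.
rewrite ger0_norm ?subr_ge0// lerBlDr (le_trans sm)//.
by rewrite -natr1 mulrDl mul1r addrC.
Unshelve. all: by end_near. Qed.

(** If [A] missed [[s, t]], the integrals of its indicator over [[0, s]] and [[0, t]] would
    coincide. This turns the Stieltjes condition into the existence of a collision time in every
    interval where the local time grows. *)
Lemma increasing_path_support (f : R -> R) (fP : increasing_path f) (A : set R) :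
  (forall t : R, 0 <= t ->
    (f t)%:E = (\int[stieltjes fP]_(s in `[0%R, t]) (\1_A s)%:E)%E) ->
  forall s t : R, 0 <= s -> s <= t -> f s < f t -> exists2 r, s <= r <= t & A r.
Proof.
move=> fA s t s0 st fst; apply: contrapT => nA.
suff : (f s)%:E = (f t)%:E by move=> [fE]; rewrite fE ltxx in fst.
rewrite !fA ?(le_trans s0)// [LHS]integral_mkcond [RHS]integral_mkcond.
apply: eq_integral => r _; rewrite !patchE.
have memE (a : R) : (r \in `[0, a]%classic) = (0 <= r <= a).
  by apply/idP/idP; rewrite inE/= in_itv.
rewrite !memE; case: (leP 0 r) => //= r0; have [rs|sr] := leP r s.
  by rewrite (le_trans rs).
case: ifPn => // rt; rewrite indicE memNset// => Ar.
by apply: nA; exists r => //; rewrite rt ltW.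
Qed.

Lemma Rintegral_itvD (b : R -> R) (s t : R) : 0 <= s -> s <= t ->
  mu.-integrable `[0, t] (EFin \o b) ->
  \int[mu]_(r in `[0, t]) b r = \int[mu]_(r in `[0, s]) b r + \int[mu]_(r in `]s, t]) b r.
Proof.
move=> s0 st ib; have := @Rintegral_itvB R b (BLeft 0) (BRight t) s ib.
by rewrite !bnd_simp => /(_ s0 st) <-; rewrite addrC subrK.
Qed.

Lemma normr_increment_integral_le (b : R -> R) (s t : R) : 0 <= s -> s <= t ->
  mu.-integrable `[0, t] (EFin \o b) ->
  `|\int[mu]_(r in `[0, t]) b r - \int[mu]_(r in `[0, s]) b r| <=
  \int[mu]_(r in `[0, t]) `|b r| - \int[mu]_(r in `[0, s]) `|b r|.
Proof.
move=> s0 st ib; have ib' : mu.-integrable `[0, t] (EFin \o (fun r => `|b r|)).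
  exact: integrable_norm.
rewrite (Rintegral_itvD s0 st ib) (Rintegral_itvD s0 st ib').
rewrite addrAC subrr add0r addrAC subrr add0r; apply: le_normr_Rintegral => //.
by apply: integrableS ib => //; apply: subset_itvr; rewrite bnd_simp.
Qed.

(** On each cell [f] is frozen at the left end, at a cost of [eta] times the integral of [|b|] over
    the cell. *)
Lemma riemann_sum_integral (f b : R -> R) (h eta C : R) (n : nat) :
  0 <= h -> osc_le h n eta f ->
  mu.-integrable `[0, n%:R * h] (EFin \o b) ->
  measurable_fun `[0, n%:R * h]%classic f -> (forall s, 0 <= s -> `|f s| <= C) ->
  `|\sum_(m < n) f (m%:R * h) * (\int[mu]_(r in `[0%R, m.+1%:R * h]) b r -
       \int[mu]_(r in `[0%R, m%:R * h]) b r)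
    - \int[mu]_(r in `[0, n%:R * h]) (f r * b r)|
  <= eta * \int[mu]_(r in `[0, n%:R * h]) `|b r|.
Proof.
move=> h0; elim: n => [|n IH] osc ib mf fC.
  rewrite big_ord0 mul0r set_itv1 !Rintegral_set1 mulr0 subrr normr0//.
have nh : 0 <= n%:R * h by rewrite mulr_ge0.
have nn : n%:R * h <= n.+1%:R * h by rewrite ler_wpM2r// ler_nat.
have ib' : mu.-integrable `[0, n.+1%:R * h] (EFin \o (fun r => `|b r|)).
  exact: integrable_norm.
have ifb : mu.-integrable `[0, n.+1%:R * h] (EFin \o (fun r => f r * b r)).
  have iCb : mu.-integrable `[0, n.+1%:R * h] (EFin \o (fun r => C * b r)).
    by apply: (integrableZl _ C ib).
  apply: le_integrable iCb => //.
    apply/measurable_EFinP; apply: measurable_funM => //.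
    by apply/measurable_EFinP; exact: (measurable_int mu ib).
  move=> s /=; rewrite in_itv/= => /andP[s0 _]; rewrite lee_fin !normrM.
  by rewrite ler_wpM2r// (le_trans (fC s s0))// ler_norm.
have sub g : mu.-integrable `[0, n.+1%:R * h] (EFin \o g) ->
    mu.-integrable `[0, n%:R * h] (EFin \o g).
  by apply: integrableS => //; apply: subset_itvl; rewrite bnd_simp.
have sub' g : mu.-integrable `[0, n.+1%:R * h] (EFin \o g) ->
    mu.-integrable `]n%:R * h, n.+1%:R * h] (EFin \o g).
  by apply: integrableS => //; apply: subset_itvr; rewrite bnd_simp.
have mf' : measurable_fun `[0, n%:R * h]%classic f.
  by apply: measurable_funS mf => //; apply: subset_itvl; rewrite bnd_simp.
have {}IH := IH (fun m s mn => osc m s (leqW mn)) (sub _ ib) mf' fC.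
rewrite big_ord_recr/= (Rintegral_itvD nh nn ib) (Rintegral_itvD nh nn ifb).
rewrite (Rintegral_itvD nh nn ib').
rewrite [_ + _ - \int[mu]_(r in `[0, n%:R * h]) b r]addrAC subrr add0r.
rewrite opprD addrACA mulrDr (le_trans (ler_normD _ _))// lerD//; last first.
  set c := f (n%:R * h).
  rewrite -RintegralZl//; last exact: sub'.
  have icb : mu.-integrable `]n%:R * h, n.+1%:R * h] (EFin \o (fun r => c * b r)).
    by apply: (integrableZl _ c (sub' _ ib)).
  rewrite -RintegralB//; last exact: sub'.
  apply: (le_trans (le_normr_Rintegral _ _)) => //.
    by apply: (integrableB _ icb (sub' _ ifb)).
  rewrite -RintegralZl//; last exact: sub'.
  apply: le_Rintegral => //.
  - by apply: integrable_norm; apply: (integrableB _ icb (sub' _ ifb)).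
  - by apply: (integrableZl _ eta (sub' _ ib')).
  - move=> s; rewrite /= in_itv/= => /andP[s0 s1].
    rewrite -mulrBl normrM ler_wpM2r// distrC; apply: osc => //; exact: ltW.
Qed.

End PathLemmas.

(** * The Lyapunov function along a path *)

Section LyapunovContinuity.
Variables (R : realType) (N : nat) (e : R).
Hypothesis e0 : 0 < e.

Lemma inv_add_norm_continuous : continuous (fun g : R => (e + `|g|)^-1).
Proof.
move=> g; apply: cvgV; first by rewrite gt_eqF// ltr_wpDr.
by apply: cvgD; [exact: cvg_cst|exact: norm_continuous].
Qed.

Lemma profile_bend_continuous : continuous (profile_bend e).
Proof.
move=> g; rewrite /profile_bend.
rewrite (_ : (fun h => _) = (fun h : R => e * ((e + `|h|)^-1 * (e + `|h|)^-1))).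
  by apply: cvgMr; apply: cvgM; exact: inv_add_norm_continuous.
by apply/funext => h; rewrite -expr2 exprVn.
Qed.

Lemma profile_slope_continuous : continuous (profile_slope e).
Proof.
move=> g; rewrite (_ : profile_slope e = (fun h => e * profile_bend e h)).
  by apply: cvgMr; exact: profile_bend_continuous.
by apply/funext => h; exact: profile_slope_bend.
Qed.

Section Filtered.
Variables (S : Type) (F : set_system S) (y : S -> 'rV[R]_N) (x : 'rV[R]_N).
Context {FF : Filter F}.
Hypothesis yx : forall j, (y s)$j @[s --> F] --> x$j.

Let slope_cvg (f : S -> R) (a : R) : f @ F --> a ->
  profile_slope e (f s) @[s --> F] --> profile_slope e a.
Proof. by move=> fa; apply: (cvg_comp _ _ fa); exact: profile_slope_continuous. Qed.

Let bend_cvg (f : S -> R) (a : R) : f @ F --> a ->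
  profile_bend e (f s) @[s --> F] --> profile_bend e a.
Proof. by move=> fa; apply: (cvg_comp _ _ fa); exact: profile_bend_continuous. Qed.

Lemma lyapunov_grad_cvg_comp i : lyapunov_grad e (y s) i @[s --> F] --> lyapunov_grad e x i.
Proof.
rewrite /lyapunov_grad; apply: cvgD; last first.
  apply: cvg_sum => j _; apply: cvgMr; apply: slope_cvg; exact: cvgB.
apply: cvgD; first by apply: cvgB => //; exact: cvg_cst.
apply: cvgMr; apply: cvgB; first exact: slope_cvg.
by apply: slope_cvg; apply: cvgB => //; exact: cvg_cst.
Qed.

Lemma lyapunov_bend_cvg_comp i : lyapunov_bend e (y s) i @[s --> F] --> lyapunov_bend e x i.
Proof.
rewrite /lyapunov_bend; apply: cvgD; apply: cvgMr; last first.
  by apply: cvg_sum => j _; apply: bend_cvg; exact: cvgB.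
apply: cvgD; first exact: bend_cvg.
by apply: bend_cvg; apply: cvgB => //; exact: cvg_cst.
Qed.

End Filtered.

Lemma lyapunov_grad_continuous (i : 'I_N) : continuous (fun x => lyapunov_grad e x i).
Proof.
move=> x; apply: (@lyapunov_grad_cvg_comp _ (nbhs x) id x (nbhs_filter x)) => j.
exact: coord_continuous.
Qed.

Lemma lyapunov_weight_continuous (i : 'I_N) :
  continuous (fun x => 1 - 2 * lyapunov_bend e x i).
Proof.
have H (S : Type) (F : set_system S) (y : S -> 'rV[R]_N) (x : 'rV[R]_N) : Filter F ->
    (forall j, (y s)$j @[s --> F] --> x$j) ->
    (1 - 2 * lyapunov_bend e (y s) i) @[s --> F] --> 1 - 2 * lyapunov_bend e x i.
  move=> FF yx; apply: cvgB; first exact: cvg_cst.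
  by apply: cvgMr; exact: lyapunov_bend_cvg_comp.
move=> x; apply: (@H _ (nbhs x) id x (nbhs_filter x)) => j.
exact: coord_continuous.
Qed.

End LyapunovContinuity.

(** * Increments of the corrected energy along one path *)

Section Pathwise.
Variables (R : realType) (N : nat) (c : R).
Local Notation mu := (@lebesgue_measure R).
Variables (x : R -> 'rV[R]_N) (w : 'I_N -> R -> R) (l : 'I_N.+1 -> R -> R).
Hypothesis x_closure : forall t, 0 <= t -> closure (@Sigma R N) (x t).
Hypothesis l_nd : forall k s t, 0 <= s -> s <= t -> l k s <= l k t.
Hypothesis l_support : forall k s t, 0 <= s -> s <= t -> l k s < l k t ->
  exists2 r, s <= r <= t & pt (x r) k = pt (x r) k.+1.
Hypothesis drift_integrable : forall t j, 0 <= t ->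
  mu.-integrable `[0, t] (EFin \o (fun s => drift (x s) j)).
Hypothesis equation : forall t j, 0 <= t ->
  (x t)$j = (x 0)$j + c * (\int[mu]_(s in `[0, t]) drift (x s) j)
    + Num.sqrt 2 * w j t + l (widen_ord (leqnSn N) j) t - l (lift ord0 j) t.
Hypothesis x_continuous : continuous_path x.
Hypothesis w_continuous : forall i, continuous_path (w i).

Variable e : R.
Hypotheses (e0 : 0 < e) (e1 : e <= 1).

Let D i s := lyapunov_grad e (x s) i.
Let K i s := 1 - 2 * lyapunov_bend e (x s) i.
Let B i t := \int[mu]_(s in `[0, t]) drift (x s) i.
Let V i t := \int[mu]_(s in `[0, t]) `|drift (x s) i|.
Let KB : R := 1 + 12 * N%:R * e^-1.

Let K_bound i s : 0 <= s -> `|K i s| <= KB.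
Proof.
move=> s0; have := lyapunov_bend_bound (x s) i e0.
have := lyapunov_bend_ge0 (x s) i e0; rewrite /K /KB.
have : 0 <= N%:R * e^-1 by rewrite mulr_ge0// invr_ge0 ltW.
rewrite -!mulrA; move: (N%:R * _) (lyapunov_bend _ _ _) => p q p0 q0 qp.
by rewrite ler_norml; apply/andP; split; lra.
Qed.

Let D_bound i s : 0 <= s -> `|D i s| <= 4 * N%:R + 1.
Proof.
by move=> s0; apply: normr_lyapunov_grad_le => //; exact/closure_Sigma_ordered/x_closure.
Qed.

Let D_continuous i : continuous_path (D i).
Proof.
apply: (continuous_path_comp (g := fun y => lyapunov_grad e y i) x_continuous).
exact: lyapunov_grad_continuous.
Qed.

Let K_continuous i : continuous_path (K i).
Proof.
apply: (continuous_path_comp (g := fun y => 1 - 2 * lyapunov_bend e y i) x_continuous).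
exact: lyapunov_weight_continuous.
Qed.

(** The factor of the oscillation [eta] in the discretisation error. It is independent of the mesh,
    so it may depend badly on [e] and on the path. *)
Definition partition_error (T : R) : R :=
  N%:R * T + `|c| * \sum_(i < N) V i T
  + 2 * \sum_(k < N.+1) (l k T - l k 0)
  + 3 * KB * \sum_(i < N) (`|c| * V i T
      + (l (widen_ord (leqnSn N) i) T - l (widen_ord (leqnSn N) i) 0)
      + (l (lift ord0 i) T - l (lift ord0 i) 0)).

(** The formal lower bound for the accumulated drift, local times left out: the coefficient [K / 2]
    of [dx^2] meets the quadratic variation [2 dt]. *)
Definition drift_balance (T : R) : R :=
  c * \sum_(i < N) \int[mu]_(s in `[0, T]) (D i s * drift (x s) i)
  + \sum_(i < N) \int[mu]_(s in `[0, T]) K i s.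

Section Partition.
Variables (h eta : R) (n : nat).
Hypothesis h0 : 0 <= h.
Local Notation tm m := (m%:R * h).
Hypothesis eta0 : 0 <= eta.
Hypothesis oscx : forall i, osc_le h n eta (fun s => (x s)$i).
Hypothesis oscw : forall i, osc_le h n eta (w i).
Hypothesis oscD : forall i, osc_le h n eta (D i).
Hypothesis oscK : forall i, osc_le h n eta (K i).

Let T := tm n.
Let dl k (m : nat) := l k (tm m.+1) - l k (tm m).
Let dw i (m : nat) := w i (tm m.+1) - w i (tm m).
Let dB i (m : nat) := B i (tm m.+1) - B i (tm m).
Let dx i (m : nat) := (x (tm m.+1))$i - (x (tm m))$i.
Let dA i (m : nat) := c * dB i m + dl (widen_ord (leqnSn N) i) m - dl (lift ord0 i) m.

Let tm0 (m : nat) : 0 <= tm m. Proof. exact: mulr_ge0. Qed.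
Let tmS (m : nat) : tm m <= tm m.+1. Proof. by rewrite ler_wpM2r// ler_nat. Qed.

(** The part to be treated as a martingale; the compensator [K h] subtracted here reappears as the
    Riemann sum of the second term of [drift_balance]. *)
Definition noise : R := \sum_(i < N) \sum_(m < n)
  (Num.sqrt 2 * D i (tm m) * dw i m + K i (tm m) * (dw i m ^+ 2 - h)).

Let dxE i m : dx i m = dA i m + Num.sqrt 2 * dw i m.
Proof.
rewrite /dx (equation i (tm0 m.+1)) (equation i (tm0 m)) /dA /dB /dl /dw /B.
by ring.
Qed.

Let dl_ge0 k m : 0 <= dl k m.
Proof. by rewrite subr_ge0 l_nd. Qed.

Let variation i (m : nat) : R :=
  `|c| * (V i (tm m.+1) - V i (tm m)) + dl (widen_ord (leqnSn N) i) m + dl (lift ord0 i) m.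

Let dA_le i m : `|dA i m| <= variation i m.
Proof.
rewrite /dA /variation (le_trans (ler_normB _ _))// lerD ?(ger0_norm (dl_ge0 _ _))//.
rewrite (le_trans (ler_normD _ _))// lerD ?(ger0_norm (dl_ge0 _ _))//.
rewrite normrM ler_wpM2l//; apply: normr_increment_integral_le => //.
exact: drift_integrable.
Qed.

(** When [l^k] grows on a cell, the cell contains a collision time, at which the jump of the
    gradient across [k] is nonnegative. Moving the two gradient entries to the left end costs [eta]
    each. *)
Let reflection_ge (m : nat) : (m < n)%N ->
  - (2 * eta) * \sum_(k < N.+1) dl k m <=
  \sum_(i < N) D i (tm m) * (dl (widen_ord (leqnSn N) i) m - dl (lift ord0 i) m).
Proof.
move=> mn; rewrite (summation_by_parts (fun i => D i (tm m)) (fun k => dl k m)).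
rewrite mulr_sumr; apply: ler_sum => k _.
have [dl0|] := eqVneq (dl k m) 0; first by rewrite dl0 !mulr0.
rewrite neq_lt ltNge dl_ge0/= => dlp.
apply: ler_wpM2r => //.
have [|r /andP[r0 r1] pr] := @l_support k _ _ (tm0 m) (tmS m); first by rewrite -subr_gt0.
have kN : (k <= N)%N by rewrite -ltnS.
have rpos : 0 <= r := le_trans (tm0 m) r0.
have := lyapunov_grad_boundary e0 e1 kN pr.
have ex j : `|extend 0 (lyapunov_grad e (x r)) j - extend 0 (fun i => D i (tm m)) j| <= eta.
  rewrite /extend; case: j => [|j]; first by rewrite subrr normr0.
  by case: insub => [i|]; [exact: oscD|rewrite subrr normr0].
rewrite -[X in _ -> _ <= X - _]/(extend 0 (fun i => D i (tm m)) k.+1).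
have := ex k; have := ex k.+1; rewrite !ler_norml.
move: (extend _ _ _) (extend _ _ _) (extend _ _ _) (extend _ _ _) => a b a' b'.
by move=> /andP[? ?] /andP[? ?] ?; lra.
Qed.

(** [dx^2 - 2 dw^2] factors as [(dx - sqrt 2 dw) (dx + sqrt 2 dw)]: the first factor is the
    finite-variation increment [dA], the second is at most [3 eta]. *)
Let second_order_ge i (m : nat) : (m < n)%N ->
  - (KB * (3 * eta) * variation i m) <= K i (tm m) / 2 * (dx i m ^+ 2 - 2 * dw i m ^+ 2).
Proof.
move=> mn.
have s2 : Num.sqrt 2 <= 2 :> R.
  by have := sqr_sqrtr (ler0n R 2); have := sqrtr_ge0 (2 : R); nra.
have E : dx i m ^+ 2 - 2 * dw i m ^+ 2 = dA i m * (dx i m + Num.sqrt 2 * dw i m).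
  rewrite -[X in _ - X * _](sqr_sqrtr (ler0n R 2)) dxE; ring.
have hx : `|dx i m| <= eta by apply: oscx.
have hw : `|dw i m| <= eta by apply: oscw.
rewrite lerNl (le_trans (ler_norm _))// normrN E !normrM mulrA.
have -> : KB * (3 * eta) * variation i m = KB / 2 * variation i m * (6 * eta) by field.
have KB0 : 0 <= KB := le_trans (normr_ge0 _) (K_bound i (tm0 m)).
have v0 : 0 <= variation i m := le_trans (normr_ge0 _) (dA_le i m).
apply: ler_pM => //.
  apply: ler_pM => //.
  by rewrite [`|2^-1|]ger0_norm// ler_wpM2r// K_bound.
rewrite (le_trans (ler_normD _ _))// normrM (ger0_norm (sqrtr_ge0 _)).
have := sqrtr_ge0 (2 : R); have := normr_ge0 (dw i m).
by move: `|dw i m| `|dx i m| hx hw (Num.sqrt 2) s2 => p q hq hp s; nra.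
Qed.

Lemma lyapunov_increment_ge :
  noise + drift_balance T - partition_error T * eta <=
  lyapunov e (x T) - lyapunov e (x 0).
Proof.
have -> : lyapunov e (x T) - lyapunov e (x 0) =
    \sum_(m < n) (lyapunov e (x (tm m.+1)) - lyapunov e (x (tm m))).
  rewrite -(big_mkord xpredT (fun m => lyapunov e (x (tm m.+1)) - lyapunov e (x (tm m)))).
  by rewrite telescope_sumr// mul0r.
have ox t : 0 <= t -> ordered (x t) by move=> t0; exact/closure_Sigma_ordered/x_closure.
apply: le_trans; last first.
  apply: ler_sum => m _; apply: lyapunov_taylor => //; exact: ox.
have tel (f : R -> R) : \sum_(m < n) (f (tm m.+1) - f (tm m)) = f T - f 0.
  rewrite -(big_mkord xpredT (fun m => f (tm m.+1) - f (tm m))).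
  by rewrite telescope_sumr// mul0r.
(* Insert [dx = dA + sqrt 2 dw] in the first-order term and [dx^2 = 2 dw^2 + (dx^2 - 2 dw^2)] in the
   second, where [2^-1 - lyapunov_bend] is [K / 2]. *)
have -> : \sum_(m < n) \sum_(i < N)
     (lyapunov_grad e (x (tm m)) i * ((x (tm m.+1))$i - (x (tm m))$i) +
      (2^-1 - lyapunov_bend e (x (tm m)) i) * ((x (tm m.+1))$i - (x (tm m))$i) ^+ 2) =
    noise
    + (c * \sum_(i < N) \sum_(m < n) D i (tm m) * dB i m
       + \sum_(i < N) \sum_(m < n) K i (tm m) * h)
    + (\sum_(m < n) \sum_(i < N) D i (tm m) * (dl (widen_ord (leqnSn N) i) m - dl (lift ord0 i) m)
    + \sum_(m < n) \sum_(i < N) K i (tm m) / 2 * (dx i m ^+ 2 - 2 * dw i m ^+ 2)).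
  pose S (f : 'I_N -> nat -> R) := \sum_(m < n) \sum_(i < N) f i m.
  have SD f g : S f + S g = S (fun i m => f i m + g i m).
    by rewrite /S -big_split; apply: eq_bigr => m _; rewrite big_split.
  have SZ a f : a * S f = S (fun i m => a * f i m).
    by rewrite /S mulr_sumr; apply: eq_bigr => m _; rewrite mulr_sumr.
  have SE (f : 'I_N -> nat -> R) : \sum_(i < N) \sum_(m < n) f i m = S f by rewrite exchange_big.
  rewrite /noise (SE (fun i m => D i (tm m) * dB i m)) (SE (fun i m => K i (tm m) * h)).
  rewrite (SE (fun i m => Num.sqrt 2 * D i (tm m) * dw i m + K i (tm m) * (dw i m ^+ 2 - h))).
  rewrite SZ -[X in _ = _ + (X + _)]/(S (fun i m => D i (tm m) *
    (dl (widen_ord (leqnSn N) i) m - dl (lift ord0 i) m))).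
  rewrite -[X in _ = _ + (_ + X)]/(S (fun i m => K i (tm m) / 2 * (dx i m ^+ 2 - 2 * dw i m ^+ 2))).
  rewrite !SD; apply: eq_bigr => m _; apply: eq_bigr => i _.
  rewrite -/(dx i (nat_of_ord m)) -/(D i (tm m)).
  have -> : D i (tm m) * dx i m = D i (tm m) * (dA i m + Num.sqrt 2 * dw i m) by rewrite dxE.
  by rewrite /K /dA; move: (lyapunov_bend _ _ _) (dx i m) (D i _) => p q r; field.
have T0 : 0 <= T := tm0 n.
(* [E1] to [E4] bound the four pieces other than [noise]; their errors are, in this order, the four
   terms of [partition_error]. *)
have E1 : \sum_(i < N) (\int[mu]_(s in `[0, T]) K i s) - N%:R * T * eta <=
    \sum_(i < N) \sum_(m < n) K i (tm m) * h.
  have -> : N%:R * T * eta = \sum_(i < N) T * eta.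
    by rewrite sumr_const card_ord -mulrA mulr_natl.
  rewrite -sumrB; apply: ler_sum => i _.
  have len (t : R) : 0 <= t -> \int[mu]_(s in `[0, t]) 1 = t.
    move=> t0; rewrite Rintegral_cst//= lebesgue_measure_itv/= lte_fin mul1r.
    have [t1|t1|<-] := ltgtP 0 t; rewrite ?oppr0 ?addr0 ?subr0//=.
    by move: t0; rewrite leNgt t1.
  have i1 : mu.-integrable `[0, n%:R * h] (EFin \o (fun=> 1)).
    apply: continuous_compact_integrable; first exact: segment_compact.
    by apply: continuous_subspaceT => s; exact: cvg_cst.
  have mK : measurable_fun `[0, n%:R * h]%classic (K i).
    apply: measurable_path => //.
    by move=> s; rewrite /= in_itv/= => /andP[].
  have := riemann_sum_integral h0 (oscK i) i1 mK (@K_bound i).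
  under [\int[mu]_(r in _) `|1|]eq_Rintegral do rewrite normr1.
  under [\int[mu]_(r in _) (_ * 1)]eq_Rintegral do rewrite mulr1.
  rewrite len//; under eq_bigr => m _.
    rewrite !len// -mulrBl -natrB// subSnn mul1r; over.
  rewrite ler_norml => /andP[+ _]; rewrite -/T.
  by move: (\sum_(m < n) _) (Rintegral _ _ _) => p q; lra.
have E2 : c * \sum_(i < N) \int[mu]_(s in `[0, T]) (D i s * drift (x s) i)
      - `|c| * (\sum_(i < N) V i T) * eta <=
    c * \sum_(i < N) \sum_(m < n) D i (tm m) * dB i m.
  rewrite lerBlDl -lerBlDr -mulrBr -sumrB.
  rewrite (le_trans (ler_norm _))// normrM -mulrA ler_wpM2l//.
  rewrite (le_trans (ler_norm_sum _ _ _))// mulr_suml; apply: ler_sum => i _.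
  have mD : measurable_fun `[0, n%:R * h]%classic (D i).
    apply: measurable_path => //.
    by move=> s; rewrite /= in_itv/= => /andP[].
  have := riemann_sum_integral h0 (oscD i) (drift_integrable i T0) mD (@D_bound i).
  by rewrite distrC (mulrC eta).
have E3 : - (2 * eta) * \sum_(k < N.+1) (l k T - l k 0) <=
    \sum_(m < n) \sum_(i < N) D i (tm m) * (dl (widen_ord (leqnSn N) i) m - dl (lift ord0 i) m).
  have -> : \sum_(k < N.+1) (l k T - l k 0) = \sum_(m < n) \sum_(k < N.+1) dl k m.
    by rewrite exchange_big; apply: eq_bigr => k _; rewrite -tel.
  by rewrite mulr_sumr; apply: ler_sum => m _; exact: reflection_ge.
have E4 : - (KB * (3 * eta) * \sum_(i < N) (`|c| * V i T
      + (l (widen_ord (leqnSn N) i) T - l (widen_ord (leqnSn N) i) 0)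
      + (l (lift ord0 i) T - l (lift ord0 i) 0))) <=
    \sum_(m < n) \sum_(i < N) K i (tm m) / 2 * (dx i m ^+ 2 - 2 * dw i m ^+ 2).
  rewrite exchange_big mulr_sumr -sumrN; apply: ler_sum => i _ /=.
  have -> : `|c| * V i T + (l (widen_ord (leqnSn N) i) T - l (widen_ord (leqnSn N) i) 0)
      + (l (lift ord0 i) T - l (lift ord0 i) 0) = \sum_(m < n) variation i m.
    rewrite /variation 2!big_split/= -mulr_sumr /dl.
    rewrite (tel (V i)) (tel (l (widen_ord (leqnSn N) i))) (tel (l (lift ord0 i))).
    by rewrite {3}/V set_itv1 Rintegral_set1 subr0.
  by rewrite mulr_sumr -sumrN; apply: ler_sum => m _; exact: second_order_ge.
rewrite /drift_balance /partition_error.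
by lra.
Qed.

End Partition.

Lemma lyapunov_increment_near (T del : R) : 0 < T -> 0 < del ->
  \forall n \near \oo,
    noise (T / n.+1%:R) n.+1 + drift_balance T - del <= lyapunov e (x T) - lyapunov e (x 0).
Proof.
move=> T0 del0; pose eta := del / (`|partition_error T| + 1).
have M0 : 0 < `|partition_error T| + 1 by rewrite ltr_wpDl.
have eta0 : 0 < eta by rewrite divr_gt0.
have le_del : partition_error T * eta <= del.
  rewrite /eta mulrCA ler_piMr ?(ltW del0)// ler_pdivrMr// mul1r.
  by rewrite (le_trans (ler_norm _))// lerDl.
have coord_path i : continuous_path (fun s => (x s)$i).
  apply: (continuous_path_comp (g := fun y : 'rV[R]_N => y$i) x_continuous).
  exact: coord_continuous.
near=> n.
have nT : n.+1%:R * (T / n.+1%:R) = T by rewrite mulrCA divff ?mulr1// pnatr_eq0.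
have h0 : 0 <= T / n.+1%:R by rewrite divr_ge0// ltW.
have := @lyapunov_increment_ge (T / n.+1%:R) eta n.+1 h0 (ltW eta0).
rewrite nT => key; apply: le_trans (key _ _ _ _); first by rewrite lerD2l lerN2.
- by near: n; apply: filter_forall => i; exact: osc_le_near.
- by near: n; apply: filter_forall => i; exact: osc_le_near.
- by near: n; apply: filter_forall => i; exact: osc_le_near.
- by near: n; apply: filter_forall => i; exact: osc_le_near.
Unshelve. all: by end_near. Qed.
End Pathwise.

(** * Limits *)

Section IteratedFatou.
Variables (R : realType) (d : measure_display) (T : measurableType d).
Variable P : probability T R.

Lemma limn_einf_ge (u : (\bar R)^nat) (a : \bar R) :
  (\forall n \near \oo, (a <= u n)%E) -> (a <= limn_einf u)%E.
Proof.
move=> [m _ au]; rewrite limn_einf_lim; apply: lime_ge; first exact: is_cvg_einfs.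
exists m => // n /= mn; apply: le_ereal_inf_tmp => _ [k /= nk <-].
by apply: au => /=; exact: leq_trans nk.
Qed.

Lemma limn_einf_le (u : (\bar R)^nat) (a : \bar R) :
  (\forall n \near \oo, (u n <= a)%E) -> (limn_einf u <= a)%E.
Proof.
move=> [m _ au]; rewrite limn_einf_lim; apply: lime_le; first exact: is_cvg_einfs.
exists m => // n /= mn; apply: le_trans (au n mn).
by apply: ereal_inf_lbound; exists n => /=.
Qed.

Lemma measurable_limn_einf (f : (T -> \bar R)^nat) :
  (forall n, measurable_fun [set: T] (f n)) ->
  measurable_fun [set: T] (fun x => limn_einf (f ^~ x)).
Proof.
move=> mf; apply: (emeasurable_fun_cvg (fun n x => einfs (f ^~ x) n)).
  by move=> n; exact: measurable_fun_einfs.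
by move=> x _; rewrite limn_einf_lim; exact: is_cvg_einfs.
Qed.

(** Fatou's lemma in [n], then in [j]. The threshold for [n] may depend on [j] and on the sample
    point, so no diagonal sequence has to be chosen. *)
Lemma iterated_fatou (f : nat -> nat -> T -> \bar R) (C r : \bar R) :
  (forall j n, measurable_fun [set: T] (f j n)) ->
  (forall j n x, (0 <= f j n x)%E) -> (0 <= r)%E ->
  (forall j, \forall n \near \oo, (\int[P]_x f j n x <= C)%E) ->
  {ae P, forall x, \forall j \near \oo, \forall n \near \oo, (r <= f j n x)%E} ->
  (r <= C)%E.
Proof.
move=> mf f0 r0 fC fr.
pose g j x := limn_einf (f j ^~ x).
have mg j : measurable_fun [set: T] (g j) by exact: measurable_limn_einf.
have g0 j x : (0 <= g j x)%E by apply: limn_einf_ge; near=> n.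
have gC j : (\int[P]_x g j x <= C)%E.
  apply: le_trans (fatou P measurableT (mf j) (fun n x _ => f0 j n x)) _.
  exact: limn_einf_le.
have h0 x : (0 <= limn_einf (g ^~ x))%E by apply: limn_einf_ge; near=> n.
have hC : (\int[P]_x limn_einf (g ^~ x) <= C)%E.
  apply: le_trans (fatou P measurableT mg (fun n x _ => g0 n x)) _.
  by apply: limn_einf_le; near=> n.
apply: le_trans hC.
have -> : r = (\int[P]_x cst r x)%E.
  by rewrite integral_cst//= [P _]probability_setT mule1.
apply: ae_ge0_le_integral => //; first exact: measurable_limn_einf.
apply: filterS fr => x fr _; apply: limn_einf_ge; apply: filterS fr => j.
exact: limn_einf_ge.
Unshelve. all: by end_near. Qed.

End IteratedFatou.

Section DominatedRintegral.
Variables (R : realType) (d : measure_display) (T : measurableType d).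
Variable m : {measure set T -> \bar R}.

Lemma cvg_Rintegral_dominated (A : set T) (f_ : nat -> T -> R) (f g : T -> R) :
  measurable A -> (forall n, measurable_fun A (f_ n)) -> measurable_fun A f ->
  {ae m, forall x, A x -> f_ n x @[n --> \oo] --> f x} ->
  m.-integrable A (EFin \o g) ->
  {ae m, forall x n, A x -> `|f_ n x| <= g x} ->
  \int[m]_(x in A) f_ n x @[n --> \oo] --> \int[m]_(x in A) f x.
Proof.
move=> mA mf_ mf cf ig fg.
have [] := @dominated_convergence _ _ _ m A mA (fun n => EFin \o f_ n) (EFin \o f) (EFin \o g).
- by move=> n; apply/measurable_EFinP.
- exact/measurable_EFinP.
- apply: filterS cf => x cx Ax; apply: cvg_EFin; last exact: cx.
  by near=> n.
- by [].
- by apply: filterS fg => x gx n Ax; rewrite /= lee_fin; exact: gx.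
move=> fi _ cI; apply: (fine_cvg (f := fun n => \int[m]_(x in A) (f_ n x)%:E)%E).
by rewrite /Rintegral fineK//; exact: (integrable_fin_num mA fi).
Unshelve. all: by end_near. Qed.

End DominatedRintegral.

(** * The drift balance as [e] tends to 0 *)

Section DriftBalanceLimit.
Variables (R : realType) (N : nat) (c T : R).
Hypothesis c0 : c <= 0.
Hypothesis T0 : 0 < T.
Local Notation mu := (@lebesgue_measure R).
Local Notation u := (N.+1%:R^-1 : R).
Local Notation eps n := (n.+1%:R^-1 : R).
Variable x : R -> 'rV[R]_N.
Hypothesis x_closure : forall t, 0 <= t -> closure (@Sigma R N) (x t).
Hypothesis x_continuous : continuous_path x.
Hypothesis drift_integrable : forall t j, 0 <= t ->
  mu.-integrable `[0, t] (EFin \o (fun s => drift (x s) j)).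
Hypothesis x_interior : {ae mu, forall s : R, 0 <= s -> Sigma (x s)}.

Let in0T (s : R) : `[0, T]%classic s -> 0 <= s.
Proof. by rewrite /= in_itv/= => /andP[]. Qed.

Let path_comp_measurable (g : 'rV[R]_N -> R) : continuous g ->
  measurable_fun `[0, T]%classic (fun s => g (x s)).
Proof.
by move=> cg; apply: measurable_path => //; exact: (continuous_path_comp x_continuous).
Qed.

Let drift_measurable i : measurable_fun `[0, T]%classic (fun s => drift (x s) i).
Proof. by apply/measurable_EFinP; exact: (measurable_int mu (drift_integrable i (ltW T0))). Qed.

Let length_T : \int[mu]_(s in `[0, T]) 1 = T.
Proof.
by rewrite Rintegral_cst//= lebesgue_measure_itv/= lte_fin T0 mul1r oppr0 addr0.
Qed.

Let integrable_cst a : mu.-integrable `[0, T] (EFin \o cst a).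
Proof.
apply: continuous_compact_integrable; first exact: segment_compact.
by apply: continuous_subspaceT => s; exact: cvg_cst.
Qed.

Let integrable_crowding : mu.-integrable `[0, T] (EFin \o (fun s => crowding (x s))).
Proof.
rewrite /crowding.
apply: (@integrableD _ _ _ mu _ _ (EFin \o cst N.+1%:R)
  (EFin \o (fun s => \sum_(j < N) `|drift (x s) j|))) => //.
rewrite (_ : EFin \o _ = fun s => (\sum_(j < N) `|drift (x s) j|%:E)%E); last first.
  by apply/funext => s /=; rewrite sumEFin.
apply: integrable_sum => // j _.
exact: (integrable_norm (drift_integrable j (ltW T0))).
Qed.

Let grad_limit i :
  \int[mu]_(s in `[0, T]) (lyapunov_grad (eps n) (x s) i * drift (x s) i) @[n --> \oo] -->
  \int[mu]_(s in `[0, T]) (((x s)$i - i.+1%:R * u) * drift (x s) i).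
Proof.
apply: (@cvg_Rintegral_dominated R _ _ mu `[0, T]%classic
  (fun n s => lyapunov_grad (eps n) (x s) i * drift (x s) i)
  (fun s => ((x s)$i - i.+1%:R * u) * drift (x s) i)
  (fun s => (4 * N%:R + 1) * `|drift (x s) i|)) => //.
- move=> n; apply: measurable_funM; last exact: drift_measurable.
  apply: (path_comp_measurable (g := fun y => lyapunov_grad (eps n) y i)).
  by apply: lyapunov_grad_continuous; rewrite invr_gt0.
- apply: measurable_funM; last exact: drift_measurable.
  apply: measurable_funB => //.
  by apply: (path_comp_measurable (g := fun y => y$i)); exact: coord_continuous.
- apply: (filterS (F := almost_everywhere mu) _ x_interior) => s xs /in0T/xs xS.
  by apply: cvgMl; exact: lyapunov_grad_cvg.
- apply: (integrableZl _ (4 * N%:R + 1) (integrable_norm (drift_integrable i (ltW T0)))) => //.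
- apply: aeW => s n /in0T s0; rewrite normrM ler_wpM2r//.
  by apply: normr_lyapunov_grad_le; [rewrite invr_gt0|exact/closure_Sigma_ordered/x_closure].
Qed.

(** The bending created by the correction disappears here, dominated by the inverse gaps through
    [crowding]. *)
Let bend_limit i :
  \int[mu]_(s in `[0, T]) (1 - 2 * lyapunov_bend (eps n) (x s) i) @[n --> \oo] --> T.
Proof.
rewrite -[X in _ --> X]length_T.
apply: (@cvg_Rintegral_dominated R _ _ mu `[0, T]%classic
  (fun n s => 1 - 2 * lyapunov_bend (eps n) (x s) i) (cst 1)
  (fun s => 1 + 12 * N%:R * crowding (x s))) => //.
- move=> n; apply: (path_comp_measurable (g := fun y => 1 - 2 * lyapunov_bend (eps n) y i)).
  by apply: lyapunov_weight_continuous; rewrite invr_gt0.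
- apply: (filterS (F := almost_everywhere mu) _ x_interior) => s xs /in0T/xs xS.
  rewrite [X in _ --> X](_ : 1 = 1 - 2 * 0); last by rewrite mulr0 subr0.
  apply: cvgB; first exact: cvg_cst.
  by apply: cvgMr; exact: lyapunov_bend_cvg0.
- apply: (@integrableD _ _ _ mu _ _ (EFin \o cst 1)
    (EFin \o (fun s => 12 * N%:R * crowding (x s)))) => //.
  exact: (integrableZl _ (12 * N%:R) integrable_crowding).
- apply: (filterS (F := almost_everywhere mu) _ x_interior) => s xs n /in0T/xs xS.
  have en : 0 < eps n by rewrite invr_gt0.
  have := lyapunov_bend_le_crowding xS i en; have := lyapunov_bend_ge0 (x s) i en.
  move: (lyapunov_bend _ _ _) (crowding _) => p q p0 pq.
  by rewrite ler_norml; apply/andP; split; lra.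
Qed.

Lemma drift_balance_near del : 0 < del ->
  \forall n \near \oo, N%:R * T - del <= drift_balance c x (eps n) T.
Proof.
move=> del0; pose L i := \int[mu]_(s in `[0, T]) (((x s)$i - i.+1%:R * u) * drift (x s) i).
have cv : drift_balance c x (eps n) T @[n --> \oo] --> c * (\sum_(i < N) L i) + \sum_(i < N) T.
  by apply: cvgD; [apply: cvgMr|]; apply: cvg_sum => i _; [exact: grad_limit|exact: bend_limit].
have iL i : mu.-integrable `[0, T] (EFin \o (fun s => ((x s)$i - i.+1%:R * u) * drift (x s) i)).
  have := integrable_norm (drift_integrable i (ltW T0)).
  apply: le_integrable => //.
    apply/measurable_EFinP; apply: measurable_funM; last exact: drift_measurable.
  apply: measurable_funB => //.
    by apply: (path_comp_measurable (g := fun y => y$i)); exact: coord_continuous.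
  move=> s /in0T s0; rewrite lee_fin normr_id normrM ler_piMl//.
  have [/(_ i)/andP[x0 x1] _] := closure_Sigma_ordered (x_closure s0).
  have v0 : 0 <= i.+1%:R * u by rewrite mulr_ge0.
  have v1 : i.+1%:R * u <= 1 by rewrite ler_pdivrMr// mul1r ler_nat ltnW// ltnS.
  move: (i.+1%:R * u) v0 v1 ((x s)$i) x0 x1 => v v0 v1 z z0 z1.
  by rewrite ler_norml; apply/andP; split; lra.
pose k s := \sum_(i < N) ((x s)$i - i.+1%:R * u) * drift (x s) i.
have kE s : (k s)%:E = (\sum_(i < N) (((x s)$i - i.+1%:R * u) * drift (x s) i)%:E)%E.
  by rewrite sumEFin.
have ik : mu.-integrable `[0, T] (EFin \o k).
  rewrite (_ : EFin \o k = fun s => (\sum_(i < N) (((x s)$i - i.+1%:R * u) * drift (x s) i)%:E)%E).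
    by apply: integrable_sum => // i _; exact: iL.
  by apply/funext => s; exact: kE.
have L0 : \sum_(i < N) L i <= 0.
  have -> : \sum_(i < N) L i = \int[mu]_(s in `[0, T]) k s.
    apply: EFin_inj; rewrite -sumEFin /Rintegral fineK; last exact: integrable_fin_num.
    under [RHS]eq_integral do rewrite kE.
    rewrite (integral_sum _ iL)//; apply: eq_bigr => i _.
    by rewrite /L /Rintegral fineK//; exact: (integrable_fin_num _ (iL i)).
  (* The sign of [k] is known only almost everywhere; [-|k|] has the same integral and is
     nonpositive everywhere. *)
  have -> : \int[mu]_(s in `[0, T]) k s = \int[mu]_(s in `[0, T]) (-1 * `|k s|).
    have mk : measurable_fun `[0, T]%classic k.
      by apply/measurable_EFinP; exact: (measurable_int mu ik).
    congr fine; apply: ae_eq_integral => //.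
    - exact/measurable_EFinP.
    - by apply/measurable_EFinP; apply: measurable_funM => //; exact: measurableT_comp.
    - apply: (filterS (F := almost_everywhere mu) _ x_interior) => s xs /in0T/xs xS.
      by rewrite mulN1r ler0_norm ?opprK//; exact: drift_attraction_le0.
  rewrite RintegralZl//; last exact: integrable_norm.
  by rewrite mulN1r oppr_le0; exact: Rintegral_ge0.
have : N%:R * T - del < c * (\sum_(i < N) L i) + \sum_(i < N) T.
  rewrite sumr_const card_ord mulr_natl; have := mulr_le0 c0 L0; lra.
by move/(cvgr_gt _ cv); apply: filterS => n /ltW.
Qed.

End DriftBalanceLimit.

(** * Second moment of the noise *)

Section LyapunovMeasurability.
Variables (R : realType) (N : nat) (e : R).
Hypothesis e0 : 0 < e.
Variables (d : measure_display) (S : measurableType d) (y : S -> 'rV[R]_N).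
Hypothesis my : forall j, measurable_fun [set: S] (fun s => y s ord0 j).

Let slope_measurable (f : S -> R) : measurable_fun [set: S] f ->
  measurable_fun [set: S] (fun s => profile_slope e (f s)).
Proof.
move=> mf; apply: (measurableT_comp (f := profile_slope e)) => //.
by apply: continuous_measurable_fun; exact: profile_slope_continuous.
Qed.

Let bend_measurable (f : S -> R) : measurable_fun [set: S] f ->
  measurable_fun [set: S] (fun s => profile_bend e (f s)).
Proof.
move=> mf; apply: (measurableT_comp (f := profile_bend e)) => //.
by apply: continuous_measurable_fun; exact: profile_bend_continuous.
Qed.

Lemma measurable_lyapunov_grad i : measurable_fun [set: S] (fun s => lyapunov_grad e (y s) i).
Proof.
apply: measurable_funD; first apply: measurable_funD.
- by apply: measurable_funB.
- apply: measurable_funM => //; apply: measurable_funB; apply: slope_measurable => //.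
  exact: measurable_funB.
- apply: measurable_sum => j; apply: measurable_funM => //; apply: slope_measurable.
  exact: measurable_funB.
Qed.

Lemma measurable_lyapunov_bend i : measurable_fun [set: S] (fun s => lyapunov_bend e (y s) i).
Proof.
apply: measurable_funD; apply: measurable_funM => //.
  apply: measurable_funD; apply: bend_measurable => //.
  exact: measurable_funB.
under eq_fun do rewrite big_mkcond.
apply: measurable_sum => j; case: (j != i) => //; apply: bend_measurable.
exact: measurable_funB.
Qed.

End LyapunovMeasurability.

Lemma sqr_sum_le (R : realType) (N : nat) (f : 'I_N -> R) :
  (\sum_(i < N) f i) ^+ 2 <= N%:R * \sum_(i < N) f i ^+ 2.
Proof.
rewrite expr2 mulr_suml.
apply: (@le_trans _ _ (\sum_(i < N) \sum_(j < N) (f i ^+ 2 + f j ^+ 2) / 2)).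
  apply: ler_sum => i _; rewrite mulr_sumr; apply: ler_sum => j _.
  by have := sqr_ge0 (f i - f j); lra.
set S := \sum_(i < N) f i ^+ 2.
have E i : \sum_(j < N) (f i ^+ 2 + f j ^+ 2) / 2 = N%:R * f i ^+ 2 / 2 + S / 2.
  by rewrite -mulr_suml big_split/= sumr_const card_ord mulrDl -(mulr_natl (f i ^+ 2) N).
under eq_bigr do rewrite E.
rewrite big_split/= -mulr_suml -mulr_sumr -/S sumr_const card_ord -(mulr_natl (S / 2) N).
lra.
Qed.

Section NoiseBound.
Variables (R : realType) (N : nat) (d : measure_display) (T : measurableType d).
Variables (P : probability T R) (F : R -> set_system T).
Variables (w : 'I_N -> R -> T -> R) (x : R -> T -> 'rV[R]_N).
Hypothesis filF : filtration F.
Hypothesis bw : forall j, brownian_motion P F (w j).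
Hypothesis x_adapted : forall j, adapted F (fun t om => x t om ord0 j).
Hypothesis x_closure : forall (t : R) om, 0 <= t -> closure (@Sigma R N) (x t om).
Variables (e h : R).
Hypotheses (e0 : 0 < e) (h0 : 0 < h).

Let a i (m : nat) om := Num.sqrt 2 * lyapunov_grad e (x (m%:R * h) om) i.
Let b i (m : nat) om := 1 - 2 * lyapunov_bend e (x (m%:R * h) om) i.
Let A : R := 2 * (4 * N%:R + 1) ^+ 2.
Let B : R := (1 + 12 * N%:R * e^-1) ^+ 2.

Let aA i m om : a i m om ^+ 2 <= A.
Proof.
rewrite exprMn sqr_sqrtr// ler_wpM2l// -real_normK ?num_real//.
rewrite lerXn2r ?nnegrE ?addr_ge0 ?mulr_ge0//.
apply: normr_lyapunov_grad_le => //; apply/closure_Sigma_ordered/x_closure.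
by rewrite mulr_ge0// ltW.
Qed.

Let bB i m om : b i m om ^+ 2 <= B.
Proof.
rewrite -real_normK ?num_real//.
have c0 : 0 <= N%:R * e^-1 by rewrite mulr_ge0// invr_ge0 ltW.
have c1 : 0 <= 1 + 12 * N%:R * e^-1.
  by rewrite -mulrA; move: (N%:R * _) c0 => p p0; lra.
rewrite lerXn2r ?nnegrE//.
have := lyapunov_bend_bound (x (m%:R * h) om) i e0.
have := lyapunov_bend_ge0 (x (m%:R * h) om) i e0.
rewrite /b -!mulrA; move: (N%:R * _) c0 (lyapunov_bend _ _ _) => p p0 q q0 qp.
by rewrite ler_norml; apply/andP; split; lra.
Qed.

Let mx (m : nat) j : measurable_at F (m%:R * h) (fun om => x (m%:R * h) om ord0 j).
Proof.
apply: (adapted_measurable_at (@x_adapted j)).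
by rewrite mulr_ge0// ltW.
Qed.

Let ma i m : measurable_at F (m%:R * h) (a i m).
Proof.
apply: measurable_funM => //; apply: measurable_lyapunov_grad => // j.
exact: mx.
Qed.

Let mb i m : measurable_at F (m%:R * h) (b i m).
Proof.
apply: measurable_funB => //; apply: measurable_funM => //.
by apply: measurable_lyapunov_bend => // j; exact: mx.
Qed.

Let noise_of n om := noise (fun s => x s om) (fun i t => w i t om) e h n.

Let noiseE n om :
  noise_of n om = \sum_(i < N) martingale_transform (w i) h (a i) (b i) n om.
Proof. by []. Qed.

Let mM i n : measurable_fun [set: T] (martingale_transform (w i) h (a i) (b i) n).
Proof.
apply: (measurable_at_fun filF (t := n%:R * h)); first by rewrite mulr_ge0// ltW.
by apply: (measurable_at_martingale_transform filF (bw i)).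
Qed.

Lemma measurable_noise n : measurable_fun [set: T] (noise_of n).
Proof. by apply: (measurable_sum _ (fun i => mM i n)). Qed.

(** The cross terms between coordinates are absorbed by Cauchy-Schwarz, at the price of a factor
    [N]. *)
Lemma noise_bound n :
  (\int[P]_om (noise_of n om ^+ 2)%:E <=
   (N%:R * (N%:R * (n%:R * (2 * A * h + 258 * B * h ^+ 2))))%:E)%E.
Proof.
apply: (@le_trans _ _ (\int[P]_om (N%:R%:E *
   \sum_(i < N) (martingale_transform (w i) h (a i) (b i) n om ^+ 2)%:E))%E).
  apply: ge0_le_integral => //.
  - by move=> om _; rewrite lee_fin sqr_ge0.
  - by apply/measurable_EFinP; apply: measurable_funX; exact: measurable_noise.
  - apply: emeasurable_funM => //; apply: emeasurable_sum => i.
    by apply/measurable_EFinP; apply: measurable_funX.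
  - by move=> om _; rewrite sumEFin -EFinM lee_fin noiseE; exact: sqr_sum_le.
rewrite ge0_integralZl//; last 2 first.
- apply: emeasurable_sum => i.
  by apply/measurable_EFinP; apply: measurable_funX.
- by move=> om _; apply: sume_ge0 => i _; rewrite lee_fin sqr_ge0.
rewrite EFinM lee_wpmul2l ?lee_fin// ge0_integral_sum//; last 2 first.
- by move=> i; apply/measurable_EFinP; apply: measurable_funX.
- by move=> i om _; rewrite lee_fin sqr_ge0.
rewrite mulr_natl -[X in (_ <= (_ *+ X)%:E)%E]card_ord -sumr_const -sumEFin.
apply: lee_sum => i _.
exact: (martingale_transform_bound filF (bw i) h0 (@ma i) (@mb i) (@aA i) (@bB i)).
Qed.

End NoiseBound.

(** * Non-existence *)

Section NonExistence.
Variables (R : realType) (N : nat) (beta : R).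
Variables (d : measure_display) (T : measurableType d).
Variables (P : probability T R) (F : R -> set_system T).
Variables (w : 'I_N -> R -> T -> R) (x : R -> T -> 'rV[R]_N) (l : 'I_N.+1 -> R -> T -> R).
Hypothesis sol : solution beta P F w x l.
Hypothesis attractive : beta / N.+1%:R <= 1.
Local Notation eps n := (n.+1%:R^-1 : R).

Let noise_at (t : R) j n om :=
  noise (fun s => x s om) (fun i s => w i s om) (eps j) (t / n.+1%:R) n.+1.

Let C0 : R := N%:R * (5 * N%:R + 1).

(** The energy stays between 0 and [C0], so its drift of about [N t] must be offset by the noise;
    the 2 is one unit of slack for each of the two limits. *)
Lemma noise_near (t : R) : 0 < t ->
  {ae P, forall om, \forall j \near \oo, \forall n \near \oo,
    noise_at t j n om <= C0 + 2 - N%:R * t}.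
Proof.
move=> t0; near=> om.
have x_cl s : 0 <= s -> closure (@Sigma R N) (x s om) by exact: (sol_x_closure sol).
have l_nd k (r s : R) : 0 <= r -> r <= s -> l k r om <= l k s om.
  by move=> r0 rs; apply: (increasing_path_nd (sol_l_increasing sol k om)).
have x_cont : continuous_path (x ^~ om) by apply: (sol_x_continuous sol).
have w_cont i : continuous_path (w i ^~ om).
  by move: i; near: om; apply: filter_forall => i; exact: (bm_continuous (sol_brownian sol i)).
have x_int : {ae lebesgue_measure, forall s : R, 0 <= s -> Sigma (x s om)}.
  by near: om; exact: (sol_drift_defined sol).
have d_int (s : R) j : 0 <= s ->
    lebesgue_measure.-integrable `[0, s]%classic (EFin \o (fun r => drift (x r om) j)).
  by move: s j; near: om; exact: (sol_drift_integrable sol).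
have eqn (s : R) j : 0 <= s -> x s om ord0 j = x 0 om ord0 j
      + (beta / N.+1%:R - 1)
        * \int[lebesgue_measure]_(r in `[0, s]) drift (x r om) j
      + Num.sqrt 2 * w j s om
      + l (widen_ord (leqnSn N) j) s om - l (lift ord0 j) s om.
  by move: s j; near: om; exact: (sol_equation sol).
have l_supp k (r s : R) : 0 <= r -> r <= s -> l k r om < l k s om ->
    exists2 q, r <= q <= s & pt (x q om) k = pt (x q om) k.+1.
  apply: (@increasing_path_support _ _ (sol_l_increasing sol k om)
    [set q | pt (x q om) k = pt (x q om) k.+1]) => q q0.
  by move: q k q0; near: om; exact: (sol_l_support sol).
have c0 : beta / N.+1%:R - 1 <= 0 by rewrite subr_le0.
have := drift_balance_near c0 t0 x_cl x_cont d_int x_int (ltr01 : 0 < (1 : R)).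
apply: filterS => j jb.
have e0 : 0 < eps j by rewrite invr_gt0.
have e1 : eps j <= 1 by rewrite invf_le1// ler1n.
have := lyapunov_increment_near x_cl l_nd l_supp d_int eqn x_cont w_cont
  e0 e1 t0 (ltr01 : 0 < (1 : R)).
apply: filterS => n; rewrite -/(noise_at t j n om).
have := lyapunov_le e0 e1 (closure_Sigma_ordered (x_cl t (ltW t0))).
have := lyapunov_ge0 e0 (closure_Sigma_ordered (x_cl 0 (lexx 0))).
rewrite -/C0; move: (lyapunov _ _) (lyapunov _ _) (drift_balance _ _ _ _) jb => p q b jb.
by move: (N%:R * t) (noise_at _ _ _ _) C0 jb => a ns c *; lra.
Unshelve. all: by end_near. Qed.

(** The gradient part [N^2 (n+1) 2 A h] is [(2 N (4 N + 1))^2 t] exactly and does not involve [j].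
    The other part grows with [j] but is of order [1/(n+1)], hence eventually below 1 for each fixed
    [j]. *)
Lemma noise_second_moment_near (t : R) j : 0 < t ->
  \forall n \near \oo, (\int[P]_om (noise_at t j n om ^+ 2)%:E <=
    ((2 * N%:R * (4 * N%:R + 1)) ^+ 2 * t + 1)%:E)%E.
Proof.
move=> t0; have e0 : 0 < eps j by rewrite invr_gt0.
pose Bj : R := (1 + 12 * N%:R * (eps j)^-1) ^+ 2.
have : (fun n => N%:R * (N%:R * (258 * Bj * t ^+ 2)) * n.+1%:R^-1) @ \oo -->
    N%:R * (N%:R * (258 * Bj * t ^+ 2)) * 0.
  by apply: cvgMr; exact: cvg_harmonic.
rewrite mulr0 => /cvgr_lt/(_ _ (ltr01 : 0 < (1 : R))); apply: filterS => n nB.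
have h0 : 0 < t / n.+1%:R by rewrite divr_gt0.
apply: le_trans (noise_bound (sol_filtration sol) (sol_brownian sol)
  (sol_x_adapted sol) (sol_x_closure sol) e0 h0 n.+1) _.
rewrite lee_fin -/Bj.
have n0 : n.+1%:R != 0 :> R by rewrite pnatr_eq0.
rewrite [leLHS](_ : _ = (2 * N%:R * (4 * N%:R + 1)) ^+ 2 * t
  + N%:R * (N%:R * (258 * Bj * t ^+ 2)) * n.+1%:R^-1); first by rewrite lerD2l ltW.
by field.
Qed.

Lemma solution_contradiction : (1 <= N)%N -> False.
Proof.
move=> N1; pose K : R := (2 * N%:R * (4 * N%:R + 1)) ^+ 2.
(* The first summand makes [r >= t / 2]; the others give [t^2 / 4 >= (K + 1) t > K t + 1], so [r^2]
   exceeds the second-moment bound. *)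
pose t := 2 * (C0 + 2) + 4 * K + 4.
have N1' : 1 <= N%:R :> R by rewrite ler1n.
have K0 : 0 <= K by exact: sqr_ge0.
have C00 : 0 <= C0 by rewrite mulr_ge0// addr_ge0// mulr_ge0.
have t0 : 0 < t by rewrite /t; lra.
have Nt : t <= N%:R * t by rewrite ler_peMl// ltW.
pose r := N%:R * t - C0 - 2.
have r0 : t / 2 <= r by rewrite /r {1}/t; move: Nt; rewrite /t; lra.
have : ((r ^+ 2)%:E <= (K * t + 1)%:E)%E.
  apply: (@iterated_fatou _ _ _ P (fun j n om => (noise_at t j n om ^+ 2)%:E)).
  - move=> j n; apply/measurable_EFinP; apply: measurable_funX.
    apply: (measurable_noise (sol_filtration sol) (sol_brownian sol)
      (sol_x_adapted sol)); first by rewrite invr_gt0.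
    by rewrite divr_gt0.
  - by move=> j n om; rewrite lee_fin sqr_ge0.
  - by rewrite lee_fin sqr_ge0.
  - by move=> j; exact: noise_second_moment_near.
  - apply: filterS (noise_near t0) => om; apply: filterS => j; apply: filterS => n ns.
    (* The noise is at most [-r], so it is its opposite that is compared with [r] before
       squaring. *)
    rewrite lee_fin -[noise_at t j n om ^+ 2]sqrrN lerXn2r ?nnegrE//.
    + by rewrite (le_trans _ r0)// divr_ge0// ltW.
    + by rewrite oppr_ge0 (le_trans ns)//; move: r0; rewrite /r; lra.
    + by rewrite /r; lra.
rewrite lee_fin; apply/negP; rewrite -ltNge.
have tK : 4 * K + 4 <= t by rewrite /t; lra.
by nra.
Qed.

End NonExistence.

Theorem corollary1p5 (R : realType) (N : nat) (beta : R)
    (hN : (1 <= N)%N) (hbeta : 0 < beta) (hbeta1 : beta / N.+1%:R < 1) :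
  ~ (exists (d : measure_display) (T : measurableType d)
       (P : probability T R) (F : R -> set_system T)
       (w : 'I_N -> R -> T -> R) (x : R -> T -> 'rV[R]_N)
       (l : 'I_N.+1 -> R -> T -> R),
       solution beta P F w x l).
Proof.
move=> [d [T [P [F [w [x [l sol]]]]]]].
exact: (solution_contradiction sol (ltW hbeta1) hN).
Qed.
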